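(* The mean multiplicity of the eigenvalue $0$ of the random binary increasing tree $\mathcal{B}_n$ with $n$ vertices satisfies, as $n\to\infty$, \[\mathbb{E}(N_0(\mathcal{B}_n)) = C_1(n+1) + \sqrt{5}-2 + \mathcal{O}\big(n^{-\sqrt{5}}\big),\] where \[C_1 = \int_0^1 \frac{(8+4\sqrt{5})v^{2\sqrt{5}}+(84+36\sqrt{5})v^{\sqrt{5}}-(22+10\sqrt{5})}{(7+3\sqrt{5}-2v^{\sqrt{5}})^2} \,dv \approx 0.085753.\]
   Context: A binary increasing tree with $n$ vertices is a rooted tree in which every vertex has at most one left child and at most one right child, with vertex labels $1,\dots,n$, each used once, increasing along every path starting at the root. There are $n!$ of them, and the random binary increasing tree $\mathcal{B}_n$ is uniformly distributed among them. $N_0(T)$ is the multiplicity of $0$ as an eigenvalue of the adjacency matrix of the underlying undirected graph of $T$. $\mathbb{E}$ denotes expectation. *)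

(* Defs.v *)
From HB Require Import structures.
From mathcomp Require Import all_boot all_order all_algebra finmap.
From mathcomp Require Import all_classical all_reals all_analysis.

Set Implicit Arguments.
Unset Strict Implicit.
Unset Printing Implicit Defensive.

Import Order.TTheory GRing.Theory Num.Theory.
Import numFieldNormedType.Exports.

Local Open Scope classical_set_scope.
Local Open Scope ring_scope.

(* [Node l x r] is a vertex labelled x with left subtree l and right subtree r;
   [Empty] stands for an absent child. *)
Inductive btree : Type :=
| Empty
| Node of btree & nat & btree.

HB.instance Definition _ := gen_eqMixin btree.
HB.instance Definition _ := gen_choiceMixin btree.

(* In preorder, with repetitions if two vertices carry the same label. *)
Fixpoint labels (T : btree) : seq nat :=
  if T is Node l x r then x :: labels l ++ labels r else [::].

Definition root_label (T : btree) : option nat :=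
  if T is Node _ x _ then Some x else None.

Fixpoint increasing (T : btree) : bool :=
  if T is Node l x r then
    [&& if root_label l is Some y then (x < y)%N else true,
        if root_label r is Some y then (x < y)%N else true,
        increasing l & increasing r]
  else true.

Definition binary_increasing (n : nat) : set btree :=
  [set T | perm_eq (labels T) (iota 1 n) /\ increasing T].

(* The vertex labelled v is a child of the vertex labelled u. *)
Fixpoint child (T : btree) (u v : nat) : bool :=
  if T is Node l x r then
    [|| (u == x) && ((root_label l == Some v) || (root_label r == Some v)),
        child l u v | child r u v]
  else false.

(* Index i stands for the i-th vertex in preorder. This is the adjacency matrix
   of the underlying graph only when the labels of T are pairwise distinct. *)
Definition adjmx (R : realType) (T : btree) : 'M[R]_(size (labels T)) :=
  \matrix_(i, j) let u := nth 0%N (labels T) i in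
                 let v := nth 0%N (labels T) j in
                 (child T u v || child T v u)%:R.

Definition N0 (R : realType) (T : btree) : nat :=
  mup 0 (char_poly (adjmx R T)).

(* [binary_increasing n] is a finite set (see below), so neither the sum nor
   the cardinal takes its default value. *)
Definition mean_binary_increasing (R : realType) (n : nat) (f : btree -> R) : R :=
  (\sum_(T \in binary_increasing n) f T)
    / (#|` fset_set (binary_increasing n)|)%:R.

Definition C1 (R : realType) : R :=
  let s : R := Num.sqrt 5 in
  \int[@lebesgue_measure R]_(v in `[0, 1])
    (((8 + 4 * s) * v `^ (2 * s) + (84 + 36 * s) * v `^ s - (22 + 10 * s))
       / (7 + 3 * s - 2 * v `^ s) ^+ 2).

Fixpoint btrees (m k : nat) : seq btree :=
  if k is k'.+1 then
    Empty :: [seq Node p.1 x p.2 | p <- allpairs pair (btrees m k') (btrees m k'),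
                                   x <- iota 0 m]
  else [:: Empty].

Lemma mem_btrees (m k : nat) (T : btree) :
  (size (labels T) <= k)%N -> all (fun x => (x < m)%N) (labels T) ->
  T \in btrees m k.
Proof.
elim: k T => [|k IHk] [|l x r] //=; rewrite inE ?eqxx //.
rewrite ltnS size_cat all_cat => szT /and3P[xm lm rm].
apply/orP; right; apply/allpairsP; exists ((l, r), x) => /=; split=> //.
  apply/allpairsP; exists (l, r); split=> //=; apply: IHk => //.
    exact: leq_trans (leq_addr _ _) szT.
  exact: leq_trans (leq_addl _ _) szT.
by rewrite mem_iota.
Qed.

Lemma finite_binary_increasing (n : nat) : finite_set (binary_increasing n).
Proof.
apply: (@sub_finite_set _ _ [set` btrees n.+1 n]); last exact: finite_seq.
move=> T [/= permT _]; apply: mem_btrees; first by rewrite (perm_size permT) size_iota.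
by apply/allP => x; rewrite (perm_mem permT) mem_iota add1n => /andP[].
Qed.

(* Main.v *)
Require Import Defs.
From mathcomp Require Import all_boot all_order all_algebra finmap.
From mathcomp Require Import all_classical all_reals all_analysis.
From mathcomp Require Import ring lra.

(* Expanding the characteristic polynomial along the root shows that the
   multiplicity of 0 counts the vertices whose fringe subtree has an exposed root
   (one missed by some maximum matching), minus the other vertices.  Hence the
   probability q_n that the root is not exposed satisfies the Riccati recurrence
   n (1 - q_n) = sum_(k < n) q_k q_(n-1-k), and the mean M_n satisfies
   n M_n = 2 sum_(k < n) M_k + n (1 - 2 q_n).  Write s for the square root of 5,
   r = (7 - 3 s) / 2 and b_n(t) for the coefficient of x^n in (1 - x)^(t - 1).
   The generating function of q_n is a rational function of (1 - x)^s divided by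
   1 - x; expanding it geometrically gives the solutions
     q_n = - (1 + s) / 2 + s sum_k r^k b_n(k s),
     M_n = C (n + 1) - s - 2 - 2 s sum_k r^k (k s - 1) / (k s + 1) b_n(k s),
   which are checked termwise with Vandermonde's identity for b_n.  The terms
   k >= 1 are O(n^(-s)) uniformly enough to be summed, and expanding the
   integrand of C1 in powers of r v^s identifies C with C1.  The first eleven terms
   of that expansion also give the numerical value. *)

Import Order.TTheory GRing.Theory Num.Theory.
Import numFieldNormedType.Exports.

Set Implicit Arguments.
Unset Strict Implicit.
Unset Printing Implicit Defensive.

Local Open Scope classical_set_scope.
Local Open Scope ring_scope.

(** * Nullity of a tree *)

Section BlockDeterminant.
Variable D : idomainType.

Lemma det_bordered_diag (n1 n2 : nat) (a : D)
    (u1 : 'rV[D]_n1) (v1 : 'cV[D]_n1) (N1 : 'M[D]_n1)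
    (u2 : 'rV[D]_n2) (v2 : 'cV[D]_n2) (N2 : 'M[D]_n2) :
  \det N1 != 0 -> \det N2 != 0 ->
  \det (block_mx a%:M (row_mx u1 u2) (col_mx v1 v2) (block_mx N1 0 0 N2)) =
    a * \det N1 * \det N2 - (u1 *m \adj N1 *m v1) 0 0 * \det N2
      - \det N1 * (u2 *m \adj N2 *m v2) 0 0.
Proof.
(* Right multiplication by the block lower triangular [C], built from the adjugates,
   makes the matrix block upper triangular; [\det C] then cancels. *)
move=> d1 d2; set B := block_mx _ _ _ _.
pose w := col_mx (- \det N2 *: (\adj N1 *m v1)) (- \det N1 *: (\adj N2 *m v2)).
pose C : 'M[D]_(1 + (n1 + n2)) := block_mx (\det N1 * \det N2)%:M 0 w 1%:M.
have detC : \det C = \det N1 * \det N2.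
  by rewrite det_lblock det1 mulr1 det_scalar expr1.
apply: (@mulIf _ (\det C)); first by rewrite detC mulf_neq0.
rewrite -det_mulmx /B /C mulmx_block mulmx1 !mulmx0 !add0r mulmx1.
have -> : col_mx v1 v2 *m (\det N1 * \det N2)%:M
    + block_mx N1 0 0 N2 *m w = 0.
  rewrite mul_mx_scalar /w mul_block_col !mul0mx addr0 add0r.
  rewrite -!scalemxAr !mulmxA !mul_mx_adj !mul_scalar_mx.
  rewrite scale_col_mx add_col_mx !scalerA !mulNr.
  rewrite !scaleNr [\det N2 * _]mulrC.
  by rewrite !subrr col_mx0.
rewrite det_ublock det_ublock detC [RHS]mulrC mulrC; congr (_ * _).
rewrite /w mul_row_col -!scalemxAr !mulmxA mul_scalar_mx det_mx11.
rewrite !mxE mulr1n; ring.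
Qed.

(** Deleting the first row and column deletes the root. This turns the quadratic forms of
    [det_bordered_diag] into characteristic polynomials of rootless subtrees. *)
Lemma adj_block00 (n : nat) (a : 'M[D]_1) (u : 'rV[D]_n) (v : 'cV[D]_n) (N : 'M[D]_n) :
  \adj (block_mx a u v N) 0 0 = \det N.
Proof.
rewrite mxE /cofactor /= expr0 mul1r; congr (\det _).
apply/matrixP => i j; rewrite 2!mxE.
have e (k : 'I_n) : lift (@ord0 n) k = rshift 1 k by apply: val_inj.
by rewrite [lift _ _](e i) [lift _ _](e j) block_mxEdr.
Qed.

End BlockDeterminant.

Section CharPoly.
Variable R : realType.

(** The dimension is a free parameter, so that block shapes such as [1 + (n1 + n2)], only provably
    equal to [size (labels T)], need no casts. *)
Definition adjmx_of_size (n : nat) (T : btree) : 'M[R]_n :=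
  \matrix_(i, j) let u := nth 0%N (labels T) i in
                 let v := nth 0%N (labels T) j in
                 (child T u v || child T v u)%:R.

Definition char_tree (T : btree) : {poly R} := char_poly (adjmx R T).

Lemma char_treeE (n : nat) (T : btree) :
  size (labels T) = n -> char_tree T = \det (char_poly_mx (adjmx_of_size n T)).
Proof. by move=> <-. Qed.

(* characteristic polynomial of the forest T minus its root, with junk value 0
   for the empty tree so that [char_tree_node] holds uniformly *)
Definition char_rootless (T : btree) : {poly R} :=
  if T is Node l x r then char_tree l * char_tree r else 0.

Lemma root_label_in (T : btree) (y : nat) :
  root_label T = Some y -> y \in labels T.
Proof. by case: T => // l x r [<-]; rewrite mem_head. Qed.

Lemma child_in (T : btree) (u v : nat) :
  child T u v -> (u \in labels T) && (v \in labels T).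
Proof.
elim: T => //= l IHl x r IHr /or3P[/andP[/eqP-> /orP[]/eqP/root_label_in]||].
- by rewrite !inE !mem_cat eqxx /= => ->; rewrite orbT.
- by rewrite !inE !mem_cat eqxx /= => ->; rewrite !orbT.
- by move=> /IHl /andP[]; rewrite !inE !mem_cat => -> ->; rewrite !orbT.
- by move=> /IHr /andP[]; rewrite !inE !mem_cat => -> ->; rewrite !orbT.
Qed.

Lemma root_label_nth (T : btree) (j : nat) :
  uniq (labels T) -> (j < size (labels T))%N ->
  (root_label T == Some (nth 0%N (labels T) j)) = (j == 0%N).
Proof.
case: T => // l x r uT lt_j /=.
apply/eqP/eqP => [[E]|-> //]; apply/eqP.
by rewrite -(nth_uniq 0%N lt_j (ltn0Sn _) uT) /= -E.
Qed.

(** The first unit row vector, since preorder puts the root at index 0; for an empty subtree it is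
    the empty row, so both cases share one block form. *)
Definition root_row (n : nat) : 'rV[{poly R}]_n := \row_j (j == 0 :> nat)%:R.

Lemma uniq_node_disjoint (l r : btree) (x v : nat) : uniq (labels (Node l x r)) ->
  [/\ x \notin labels l, x \notin labels r & v \in labels l -> v \notin labels r].
Proof.
move=> /= /andP[]; rewrite mem_cat negb_or => /andP[xl xr].
rewrite cat_uniq => /and3P[_ /hasPn hd _]; split=> // vl.
by apply/negP => /hd; rewrite vl.
Qed.

(** Preorder lists the root, then [l], then [r]. As labels are distinct, no edge joins [l] to [r],
    and the root is adjacent only to index 0 of each subtree. *)
Lemma char_poly_mx_node (l r : btree) (x n1 n2 : nat) :
  size (labels l) = n1 -> size (labels r) = n2 -> uniq (labels (Node l x r)) ->
  char_poly_mx (adjmx_of_size (1 + (n1 + n2)) (Node l x r)) =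
  block_mx ('X%:M) (row_mx (- root_row n1) (- root_row n2))
    (col_mx (- (root_row n1)^T) (- (root_row n2)^T))
    (block_mx (char_poly_mx (adjmx_of_size n1 l)) 0 0 (char_poly_mx (adjmx_of_size n2 r))).
Proof.
move=> s1 s2 uT; have [xl xr _] := uniq_node_disjoint 0 uT.
have := uT; rewrite /= => /andP[_]; rewrite cat_uniq => /and3P[ul _ ur].
have nx T u : x \notin labels T -> u \in labels T -> (u == x) = false.
  by move=> xT uT'; apply/eqP => ux; move: xT; rewrite -ux uT'.
have nc T u v : (u \notin labels T) || (v \notin labels T) -> child T u v = false.
  by move=> h; apply/negP => /child_in/andP[a b]; rewrite a b in h.
have nr T v : v \notin labels T -> (root_label T == Some v) = false.
  by move=> xT; apply/eqP => /root_label_in; apply/negP.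
have nthl (j : 'I_n1) : nth 0%N (labels l ++ labels r) j = nth 0%N (labels l) j.
  by rewrite nth_cat s1 ltn_ord.
have nthr (j : 'I_n2) : nth 0%N (labels l ++ labels r) (n1 + j) = nth 0%N (labels r) j.
  by rewrite nth_cat s1 ltnNge leq_addr /= addKn.
have inl (j : 'I_n1) : nth 0%N (labels l) j \in labels l by rewrite mem_nth // s1.
have inr (j : 'I_n2) : nth 0%N (labels r) j \in labels r by rewrite mem_nth // s2.
have lr v : v \in labels l -> v \notin labels r by have [_ _] := uniq_node_disjoint v uT.
have rl v : v \in labels r -> v \notin labels l by move=> vr; apply/negP => /lr/negP.
apply/matrixP => i j.
(* Nine blocks: root against root, root against [l] and [r], the two transposed blocks, then the
   four blocks among the subtrees. *)
case: (split_ordP i) => i1 ->; case: (split_ordP j) => j1 ->.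
- rewrite block_mxEul !mxE !ord1 /= eqxx mulr1n !(nc _ x) ?xl ?xr //.
  by rewrite (nr l) // (nr r) //= subr0.
- rewrite block_mxEur; case: (split_ordP j1) => j2 ->.
    rewrite row_mxEl !mxE !ord1 /= nthl !(nc _ x) ?xl ?xr //.
    rewrite !(nc _ _ x) ?xl ?xr ?orbT // eqxx root_label_nth ?s1 //.
    rewrite nr ?lr //= (nx l) //= !orbF; case: eqP => _;
        by rewrite /= ?mulr0n ?sub0r ?oppr0 ?polyC0 ?oppr0.
  rewrite row_mxEr !mxE !ord1 /= nthr !(nc _ x) ?xl ?xr //.
  rewrite !(nc _ _ x) ?xl ?xr ?orbT // eqxx (root_label_nth ur) ?s2 //.
  rewrite nr ?rl //= (nx r) //= !orbF; case: eqP => _;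
      by rewrite /= ?mulr0n ?sub0r ?oppr0 ?polyC0 ?oppr0.
- rewrite block_mxEdl; case: (split_ordP i1) => i2 ->.
    rewrite col_mxEu !mxE !ord1 /= nthl !(nc _ x) ?xl ?xr //.
    rewrite !(nc _ _ x) ?xl ?xr ?orbT // eqxx root_label_nth ?s1 //.
    rewrite (nx l) //= nr ?lr //= !orbF; case: eqP => _;
        by rewrite /= ?mulr0n ?sub0r ?oppr0 ?polyC0 ?oppr0.
  rewrite col_mxEd !mxE !ord1 /= nthr !(nc _ x) ?xl ?xr //.
  rewrite !(nc _ _ x) ?xl ?xr ?orbT // eqxx (root_label_nth ur) ?s2 //.
  rewrite (nx r) //= nr ?rl //= !orbF; case: eqP => _;
      by rewrite /= ?mulr0n ?sub0r ?oppr0 ?polyC0 ?oppr0.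
rewrite block_mxEdr; case: (split_ordP i1) => i2 ->; case: (split_ordP j1) => j2 ->.
- rewrite block_mxEul !mxE /= !nthl !(nx l _ xl) //= !(nc r) ?lr //= !orbF.
  by rewrite !(inj_eq (@rshift_inj _ _)) (inj_eq (@lshift_inj _ _)).
- rewrite block_mxEur !mxE /= !nthl !nthr (nx l _ xl (inl i2)) (nx r _ xr (inr j2)) /=.
  have [li rj] := (lr _ (inl i2), rl _ (inr j2)).
  rewrite !nc ?li ?rj ?orbT //=.
  by rewrite (inj_eq (@rshift_inj _ _)) eq_lrshift /= subr0.
- rewrite block_mxEdl !mxE /= !nthl !nthr (nx l _ xl (inl j2)) (nx r _ xr (inr i2)) /=.
  have [lj ri] := (lr _ (inl j2), rl _ (inr i2)).
  rewrite !nc ?lj ?ri ?orbT //=.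
  by rewrite (inj_eq (@rshift_inj _ _)) eq_rlshift /= subr0.
- rewrite block_mxEdr !mxE /= !nthr !(nx r _ xr) //= !(nc l) ?rl //= .
  by rewrite !(inj_eq (@rshift_inj _ _)).
Qed.

Lemma root_row_form (n : nat) (A : 'M[{poly R}]_n.+1) :
  (- root_row n.+1 *m A *m - (root_row n.+1)^T) 0 0 = A 0 0.
Proof.
have -> : root_row n.+1 = delta_mx 0 0 by apply/rowP => j; rewrite !mxE eqxx.
by rewrite trmx_delta mulNmx mulmxN mulNmx opprK -rowE -colE !mxE.
Qed.

Lemma det_char_poly_mx_neq0 (n : nat) (A : 'M[R]_n) : \det (char_poly_mx A) != 0.
Proof. by rewrite -[X in X != 0]/(char_poly A) monic_neq0 // char_poly_monic. Qed.

(** The form picks out the corner entry of the adjugate, whose minor is block diagonal in the two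
    subtrees. For [Empty] it is an empty sum, matching the junk value 0. *)
Lemma char_tree_root_form (T : btree) (n : nat) : size (labels T) = n -> uniq (labels T) ->
  (- root_row n *m \adj (char_poly_mx (adjmx_of_size n T)) *m - (root_row n)^T) 0 0 =
      char_rootless T.
Proof.
case: T => [|l x r] sT uT.
  by move: sT => /= <-; rewrite !mxE big_ord0.
set n1 := size (labels l); set n2 := size (labels r).
have n12 : n = (1 + (n1 + n2))%N by rewrite -sT /= size_cat.
rewrite {sT}n12 root_row_form char_poly_mx_node // adj_block00 det_ublock.
by rewrite /= !(char_treeE erefl).
Qed.

Lemma char_tree_node (l r : btree) (x : nat) : uniq (labels (Node l x r)) ->
  char_tree (Node l x r) = 'X * char_tree l * char_tree r - char_rootless l * char_tree r -
      char_tree l * char_rootless r.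
Proof.
move=> uT; have := uT; rewrite /= => /andP[_]; rewrite cat_uniq => /and3P[ul _ ur].
rewrite (@char_treeE (1 + (size (labels l) + size (labels r)))); last by rewrite /= size_cat.
rewrite char_poly_mx_node // det_bordered_diag ?det_char_poly_mx_neq0 //.
by rewrite !char_tree_root_form // -!char_treeE.
Qed.

(* Some maximum matching of T misses the root. *)
Fixpoint exposed (T : btree) : bool :=
  if T is Node l x r then ~~ exposed l && ~~ exposed r else false.

(** This counts the vertices missed by a maximum matching: an exposed root stays unmatched, any
    other root is matched to an exposed child. [nullity_node] shows that the predecessor is never
    truncated at 0 when labels are distinct. *)
Fixpoint nullity (T : btree) : nat :=
  if T is Node l x r then
    if exposed T then (nullity l + nullity r).+1 else (nullity l + nullity r).-1
  else 0%N.

(* The signs of the products [p.[0] * q.[0]] exclude any cancellation between the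
   lowest terms of the three summands of [char_tree_node]. *)
Lemma char_tree_lowest_term (T : btree) : uniq (labels T) ->
  exists p q : {poly R}, [/\ char_tree T = 'X^(nullity T) * p, p.[0] != 0 &
    if exposed T then
      [/\ (0 < nullity T)%N, char_rootless T = 'X^((nullity T).-1) * q & 0 < p.[0] * q.[0]]
    else char_rootless T = 'X^((nullity T).+1) * q /\ p.[0] * q.[0] <= 0].
Proof.
elim: T => [_|l IHl x r IHr uT].
  exists 1, 0; rewrite hornerC oner_neq0 /= expr0 !mulr0 horner0 mul1r; split=> //.
  by rewrite /char_tree /char_poly det_mx00.
have := uT; rewrite /= => /andP[_]; rewrite cat_uniq => /and3P[ul _ ur].
have [pl [ql [El nl Fl]]] := IHl ul.
have [pr [qr [Er nr Fr]]] := IHr ur.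
have plr : 0 < (pl.[0] * pr.[0]) ^+ 2 by rewrite exprn_even_gt0 ?mulf_neq0.
have pl2 : 0 < pl.[0] ^+ 2 by rewrite exprn_even_gt0.
have pr2 : 0 < pr.[0] ^+ 2 by rewrite exprn_even_gt0.
rewrite char_tree_node //= El Er.
move: Fl Fr; case: (exposed l) => Fl; case: (exposed r) => Fr /=.
(* In all four cases the witness [q] is [pl * pr], as removing the root leaves both subtrees.
   Multiplying by it turns the two subtracted terms at 0 into [pl ql pr^2] and [pr qr pl^2], whose
   signs are known. Powers of [X] in the witness [p] record the gaps between the orders of the
   summands. *)
- case: Fl Fr => zl -> Hl [zr -> Hr].
  case: (nullity l) zl => // a _; case: (nullity r) zr => // b _ /=.
  exists ('X * ('X * pl * pr) - ql * pr - pl * qr), (pl * pr).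
  have neg : ('X * ('X * pl * pr) - ql * pr - pl * qr).[0] * (pl * pr).[0] < 0.
    rewrite !(hornerM, hornerD, hornerN, hornerX);
        have : 0 < (pl.[0] * ql.[0]) * pr.[0] ^+ 2 by rewrite mulr_gt0.
    have : 0 < (pr.[0] * qr.[0]) * pl.[0] ^+ 2 by rewrite mulr_gt0.
    by move=> *; lra.
  rewrite (ltW neg) !(exprD, exprS); split=> //; [ring| |split=> //; ring].
  by apply/eqP => E; rewrite E mul0r ltxx in neg.
- case: Fl Fr => zl -> Hl [-> Hr].
  case: (nullity l) zl => // a _ /=; move: (nullity r) => b.
  exists ('X * ('X * pl * pr) - ql * pr - 'X * ('X * pl * qr)), (pl * pr).
  have neg : ('X * ('X * pl * pr) - ql * pr - 'X * ('X * pl * qr)).[0] * (pl * pr).[0] < 0.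
    rewrite !(hornerM, hornerD, hornerN, hornerX);
        have : 0 < (pl.[0] * ql.[0]) * pr.[0] ^+ 2 by rewrite mulr_gt0.
    by move=> *; lra.
  rewrite (ltW neg) ?addnS /= !(exprD, exprS); split=> //; [ring| |split=> //; ring].
  by apply/eqP => E; rewrite E mul0r ltxx in neg.
- case: Fl Fr => -> Hl [zr -> Hr].
  case: (nullity r) zr => // b _ /=; move: (nullity l) => a.
  exists ('X * ('X * pl * pr) - 'X * ('X * ql * pr) - pl * qr), (pl * pr).
  have neg : ('X * ('X * pl * pr) - 'X * ('X * ql * pr) - pl * qr).[0] * (pl * pr).[0] < 0.
    rewrite !(hornerM, hornerD, hornerN, hornerX);
        have : 0 < (pr.[0] * qr.[0]) * pl.[0] ^+ 2 by rewrite mulr_gt0.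
    by move=> *; lra.
  rewrite (ltW neg) ?addnS /= !(exprD, exprS); split=> //; [ring| |split=> //; ring].
  by apply/eqP => E; rewrite E mul0r ltxx in neg.
- case: Fl Fr => -> Hl [-> Hr]; move: (nullity l) (nullity r) => a b.
  exists (pl * pr - ql * pr - pl * qr), (pl * pr).
  have pos : 0 < (pl * pr - ql * pr - pl * qr).[0] * (pl * pr).[0].
    rewrite !(hornerM, hornerD, hornerN, hornerX);
        have : (pl.[0] * ql.[0]) * pr.[0] ^+ 2 <= 0 by rewrite pmulr_lle0.
    have : (pr.[0] * qr.[0]) * pl.[0] ^+ 2 <= 0 by rewrite pmulr_lle0.
    by move=> *; lra.
  rewrite pos !(exprD, exprS); split=> //; [ring| |split=> //; ring].
  by apply/eqP => E; rewrite E mul0r ltxx in pos.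
Qed.

Lemma N0_nullity (T : btree) : uniq (labels T) -> N0 R T = nullity T.
Proof.
move=> uT; have [p [_ [E p0 _]]] := char_tree_lowest_term uT.
rewrite /N0 -[char_poly _]/(char_tree T) E mupMl; last by rewrite rootE.
by rewrite -['X]subr0 mup_XsubCX eqxx.
Qed.

(** An unexposed root has an exposed child, and the nullity of an exposed tree is positive, so 1 can
    really be subtracted. *)
Lemma nullity_node (l r : btree) (x : nat) : uniq (labels (Node l x r)) ->
  (nullity (Node l x r))%:R
    = (nullity l)%:R + (nullity r)%:R + (if exposed (Node l x r) then 1 else - 1) :> R.
Proof.
move=> uT; have := uT; rewrite /= => /andP[_]; rewrite cat_uniq => /and3P[ul _ ur].
have [pl [ql [_ _ Fl]]] := char_tree_lowest_term ul.
have [pr [qr [_ _ Fr]]] := char_tree_lowest_term ur.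
case: ifP => [_|/negbT]; first by rewrite -natrD -natr1.
rewrite negb_and !negbK => fr; rewrite -natrD.
have : (0 < nullity l + nullity r)%N.
  rewrite addn_gt0; case/orP: fr => f; [move: Fl|move: Fr]; rewrite f => -[-> _ _] //.
  by rewrite orbT.
by case: (_ + _)%N => // m _; rewrite -natr1 addrK.
Qed.

End CharPoly.

(** * Enumeration by the label set of the left subtree *)

(** All ways to share out the labels between the left and the right subtree; both parts keep the
    order of [s], hence stay sorted. *)
Fixpoint splits (s : seq nat) : seq (seq nat * seq nat) :=
  if s is x :: s' then
    [seq (x :: p.1, p.2) | p <- splits s'] ++ [seq (p.1, x :: p.2) | p <- splits s']
  else [:: ([::], [::])].

Lemma mem_splits_filter (P : pred nat) (s : seq nat) :
  ([seq x <- s | P x], [seq x <- s | ~~ P x]) \in splits s.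
Proof.
elim: s => //= x s IHs; rewrite mem_cat; case: (P x) => /=; apply/orP; [left|right].
  by apply/mapP; exists ([seq x <- s | P x], [seq x <- s | ~~ P x]).
by apply/mapP; exists ([seq x <- s | P x], [seq x <- s | ~~ P x]).
Qed.

Lemma splits_perm_subseq (s a b : seq nat) : (a, b) \in splits s ->
  [/\ perm_eq (a ++ b) s, subseq a s & subseq b s].
Proof.
elim: s a b => [|x s IHs] a b /=; first by rewrite inE => /eqP[-> ->].
rewrite mem_cat => /orP[] /mapP[[a' b'] /IHs[Hp Ha Hb] [-> ->]].
  split; rewrite /= ?eqxx // ?perm_cons //.
  exact: subseq_trans Hb (subseq_cons _ _).
split; rewrite /= ?eqxx //; last by exact: subseq_trans Ha (subseq_cons _ _).
by rewrite perm_catC /= perm_cons perm_catC.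
Qed.

Lemma uniq_splits (s : seq nat) : uniq s -> uniq (splits s).
Proof.
elim: s => //= x s IHs /andP[xs us]; rewrite cat_uniq !map_inj_uniq ?IHs //=; last 2 first.
- by move=> [a b] [a' b'] /= [-> ->].
- by move=> [a b] [a' b'] /= [-> ->].
rewrite andbT; apply/hasPn => p /mapP[[a b] ab ->] /=.
apply/mapP => -[[a' b'] _ [aE _]].
have [_ /mem_subseq sa _] := splits_perm_subseq ab.
by move: xs; rewrite sa // aE mem_head.
Qed.

(* k is fuel: the enumeration is complete only if [size s <= k]. *)
Fixpoint itrees (k : nat) (s : seq nat) : seq btree :=
  if k is k'.+1 then
    if s is x :: s' then
      flatten [seq [seq Node lr.1 x lr.2 |
                     lr <- allpairs pair (itrees k' p.1) (itrees k' p.2)] |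
                p <- splits s']
    else [:: Defs.Empty]
  else [:: Defs.Empty].

(** [increasing] compares a vertex with its children only; transitivity carries the comparison to
    all descendants. *)
Lemma increasing_root_lt (l r : btree) (x : nat) :
  increasing (Node l x r) -> all (fun y => x < y)%N (labels l ++ labels r).
Proof.
suff H T : forall x, (if root_label T is Some y then (x < y)%N else true) ->
    increasing T -> all (fun y => x < y)%N (labels T).
  by move=> /= /and4P[hl hr il ir]; rewrite all_cat !H.
elim: T => //= l' IHl y r' IHr z zy /and4P[hl hr il ir].
rewrite zy all_cat /=; apply/andP; split.
  by apply: sub_all (IHl _ hl il) => w; apply: ltn_trans.
by apply: sub_all (IHr _ hr ir) => w; apply: ltn_trans.
Qed.

(** In a sorted list the head is the minimum, which an increasing tree must carry at its root; the
    other labels are split between the subtrees. *)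
Lemma mem_itrees (k : nat) (s : seq nat) (T : btree) :
  (size s <= k)%N -> sorted ltn s ->
  (T \in itrees k s) = perm_eq (labels T) s && increasing T.
Proof.
elim: k s T => [|k IHk] [|x s] T //=.
- move=> _ _; rewrite inE; case: T => [|l y r]; first by rewrite eqxx.
  apply/idP/idP => [/eqP //|/andP[/perm_size]]; by [].
- move=> _ _; rewrite inE; case: T => [|l y r]; first by rewrite eqxx.
  apply/idP/idP => [/eqP //|/andP[/perm_size]]; by [].
rewrite ltnS => sk xs; have ss := path_sorted xs.
have us : uniq s by apply: sorted_uniq ss; [exact: ltn_trans | exact: ltnn].
have lt_xs : all (fun y => x < y)%N s by apply: order_path_min xs; exact: ltn_trans.
have sub_sorted a : subseq a s -> sorted ltn a.
  by move=> sa; apply: subseq_sorted sa ss; exact: ltn_trans.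
have sub_size a : subseq a s -> (size a <= k)%N.
  by move=> /size_subseq sa; apply: leq_trans sa sk.
apply/flattenP/andP => [[_ /mapP[[a b] /splits_perm_subseq[ps sa sb] ->]]|].
  move=> /mapP[[l r] /allpairsP[[l' r'] /= [lin rin [-> ->]]] ->].
  move: lin rin; rewrite !IHk ?sub_sorted ?sub_size // => /andP[pl il] /andP[pr ir].
  have plr : perm_eq (labels l' ++ labels r') s.
    by apply: perm_trans ps; apply: perm_cat.
  split; first by rewrite /= perm_cons.
  have lt T' y : root_label T' = Some y -> {subset labels T' <= s} -> (x < y)%N.
    by move=> /root_label_in yT /(_ _ yT) ys; apply: (allP lt_xs).
  rewrite /= il ir !andbT; apply/andP; split.
    case E: root_label => [y|] //; apply: lt E _ => w wl.
    by rewrite -(perm_mem plr) mem_cat wl.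
  case E: root_label => [y|] //; apply: lt E _ => w wl.
  by rewrite -(perm_mem plr) mem_cat wl orbT.
case: T => [|l y r] [pT iT]; first by have := perm_size pT.
have lt_yrest := increasing_root_lt iT.
(* If the root label and the head of the list differed, each would be smaller than the other. *)
have yx : y = x.
  have := perm_mem pT x; rewrite /= mem_head inE => /orP[/eqP-> //|xr].
  have := perm_mem pT y; rewrite /= mem_head inE => /esym/orP[/eqP-> //|ys].
  by have := ltn_trans (allP lt_yrest _ xr) (allP lt_xs _ ys); rewrite ltnn.
rewrite {}yx in pT iT lt_yrest *; move: pT; rewrite /= perm_cons => plr.
have ulr : uniq (labels l ++ labels r) by rewrite (perm_uniq plr).
have := ulr; rewrite cat_uniq => /and3P[ul /hasPn dlr ur].
pose P y := y \in labels l.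
exists [seq Node lr.1 x lr.2 | lr <- allpairs pair (itrees k [seq x <- s | P x])
                                                  (itrees k [seq x <- s | ~~ P x])].
  by apply/mapP; exists ([seq x <- s | P x], [seq x <- s | ~~ P x]) => //;
     exact: mem_splits_filter.
move: iT => /= /and4P[_ _ il ir].
apply/mapP; exists (l, r) => //; apply/allpairsP; exists (l, r) => /=; split => //.
  rewrite IHk ?sub_sorted ?sub_size ?filter_subseq // il andbT.
  apply: uniq_perm => // [|w]; first exact: filter_uniq.
  rewrite mem_filter -(perm_mem plr) mem_cat /P.
  by case: (w \in labels l).
rewrite IHk ?sub_sorted ?sub_size ?filter_subseq // ir andbT.
apply: uniq_perm => // [|w]; first exact: filter_uniq.
rewrite mem_filter -(perm_mem plr) mem_cat /P.
by case wr: (w \in labels r); rewrite ?orbT ?orbF ?andbT ?andNb //; apply/esym/dlr.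
Qed.

(** Different splits give disjoint families: a tree determines the label sets of its subtrees, and a
    sorted list is determined by its elements. *)
Lemma uniq_itrees (k : nat) (s : seq nat) :
  (size s <= k)%N -> sorted ltn s -> uniq (itrees k s).
Proof.
elim: k s => [|k IHk] [|x s] //=.
rewrite ltnS => sk xs; have ss := path_sorted xs.
have us : uniq s by apply: sorted_uniq ss; [exact: ltn_trans | exact: ltnn].
have sub_sorted a : subseq a s -> sorted ltn a.
  by move=> sa; apply: subseq_sorted sa ss; exact: ltn_trans.
have sub_size a : subseq a s -> (size a <= k)%N.
  by move=> /size_subseq sa; apply: leq_trans sa sk.
have eq_sorted a b : subseq a s -> subseq b s -> perm_eq a b -> a = b.
  move=> /sub_sorted sa /sub_sorted sb /perm_mem.
  by apply: (@irr_sorted_eq _ ltn) sa sb; [exact: ltn_trans | exact: ltnn].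
(* The induction runs over any duplicate-free list of members of [splits s], peeling off one split
   at a time. *)
have : all (mem (splits s)) (splits s) by apply/allP.
elim: {-2}(splits s) (uniq_splits us) => //= -[a b] S IHS /andP[abS uS] /andP[abs Ss].
rewrite cat_uniq IHS // andbT; have [_ sa sb] := splits_perm_subseq abs.
apply/andP; split.
  rewrite map_inj_uniq; last by move=> [l r] [l' r'] /= [-> ->].
  by apply: allpairs_uniq; rewrite ?IHk ?sub_sorted ?sub_size //; move=> [? ?] [? ?].
apply/hasPn => T /flattenP[_ /mapP[[a' b'] abS' ->]].
have [_ sa' sb'] := splits_perm_subseq (allP Ss _ abS').
move=> /mapP[_ /allpairsP[[l r] /= [lin rin ->]] ->] /=.
apply/negP => /mapP[_ /allpairsP[[l' r'] /= [lin' rin' ->]] /= [El Er]].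
move: lin rin lin' rin'; rewrite -{}El -{}Er !mem_itrees ?sub_sorted ?sub_size //.
move=> /andP[pa' _] /andP[pb' _] /andP[pa _] /andP[pb _].
move/negP: abS; apply.
have -> : a = a'.
  by apply: eq_sorted => //; apply: perm_trans pa'; rewrite perm_sym.
have -> // : b = b'.
by apply: eq_sorted => //; apply: perm_trans pb'; rewrite perm_sym.
Qed.

(** * Sums over increasing trees from the recurrences *)

Section Sums.
Variable R : realType.

(** Only the sizes matter, and choosing a side for the head of the list is Pascal's rule. *)
Lemma sum_splits_bin (G : nat -> nat -> R) (s : seq nat) :
  \sum_(p <- splits s) G (size p.1) (size p.2)
    = \sum_(k < (size s).+1) 'C(size s, k)%:R * G k (size s - k)%N.
Proof.
elim: s G => [|x s IHs] G /=.
  by rewrite big_seq1 big_ord_recl big_ord0 /= addr0 bin0 mul1r.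
rewrite big_cat !big_map /= (IHs (fun a b => G a.+1 b)) (IHs (fun a b => G a b.+1)).
set n := size s; rewrite [RHS]big_ord_recl /= bin0 subn0 mul1r.
under [X in _ = _ + X]eq_bigr => k _ do rewrite /bump /= add1n binS natrD mulrDl subSS.
rewrite [X in _ = _ + X]big_split /= [RHS]addrA [LHS]addrC; congr (_ + _).
rewrite [LHS]big_ord_recl [X in _ = _ + X]big_ord_recr /= bin0 subn0 mul1r.
rewrite bin_small // mul0r addr0; congr (_ + _).
by apply: eq_bigr => k _; rewrite /bump /= add1n subnSK.
Qed.

(** The factorials count the trees on either side; since they cancel the binomial coefficient, the
    size of the left subtree is uniformly distributed. *)
Lemma sum_splits (g : nat -> nat -> R) (s : seq nat) :
  \sum_(p <- splits s) (size p.1)`!%:R * (size p.2)`!%:R * g (size p.1) (size p.2)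
    = (size s)`!%:R * \sum_(k < (size s).+1) g k (size s - k)%N.
Proof.
rewrite (sum_splits_bin (fun a b => a`!%:R * b`!%:R * g a b)) mulr_sumr.
apply: eq_bigr => k _; have kn : (k <= size s)%N by rewrite -ltnS ltn_ord.
rewrite -(bin_fact kn) 2!natrM; move: (_%:R) (_%:R) (_%:R) => a b c.
by rewrite !mulrA.
Qed.

Lemma sum_itreesS (F : btree -> R) (k x : nat) (s : seq nat) :
  \sum_(T <- itrees k.+1 (x :: s)) F T
    = \sum_(p <- splits s) \sum_(l <- itrees k p.1) \sum_(r <- itrees k p.2) F (Node l x r).
Proof.
rewrite big_flatten big_map; apply: eq_bigr => p _.
by rewrite big_map big_allpairs.
Qed.

(** [q n] stands for the probability that the root is not exposed and [m n] for the mean nullity.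
    Any solution of the recurrences will do here; explicit ones are supplied at the end. *)
Variables q m : nat -> R.
Hypothesis q0 : q 0%N = 1.
Hypothesis qS : forall n, n.+1%:R * (1 - q n.+1) = \sum_(k < n.+1) q k * q (n - k)%N.
Hypothesis m0 : m 0%N = 0.
Hypothesis mS : forall n,
  n.+1%:R * m n.+1 = 2 * (\sum_(k < n.+1) m k) + n.+1%:R * (1 - 2 * q n.+1).

Lemma sum_itrees (k : nat) (s : seq nat) : (size s <= k)%N -> sorted ltn s ->
  [/\ \sum_(T <- itrees k s) (1 : R) = (size s)`!%:R,
      \sum_(T <- itrees k s) (~~ exposed T)%:R = (size s)`!%:R * q (size s) &
      \sum_(T <- itrees k s) (nullity T)%:R = (size s)`!%:R * m (size s)].
Proof.
elim: k s => [|k IHk] [|x s] //=.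
- by move=> _ _; rewrite !big_seq1 /= q0 m0 !mulr1 mulr0.
- by move=> _ _; rewrite !big_seq1 /= q0 m0 !mulr1 mulr0.
rewrite ltnS -/(itrees k.+1 (x :: s)) => sk xs; have ss := path_sorted xs.
have sub_sorted a : subseq a s -> sorted ltn a.
  by move=> sa; apply: subseq_sorted sa ss; exact: ltn_trans.
have sub_size a : subseq a s -> (size a <= k)%N.
  by move=> /size_subseq sa; apply: leq_trans sa sk.
have IHp p : p \in splits s ->
  [/\ \sum_(T <- itrees k p.1) (1 : R) = (size p.1)`!%:R,
      \sum_(T <- itrees k p.1) (~~ exposed T)%:R = (size p.1)`!%:R * q (size p.1) &
      \sum_(T <- itrees k p.1) (nullity T)%:R = (size p.1)`!%:R * m (size p.1)] /\
  [/\ \sum_(T <- itrees k p.2) (1 : R) = (size p.2)`!%:R,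
      \sum_(T <- itrees k p.2) (~~ exposed T)%:R = (size p.2)`!%:R * q (size p.2) &
      \sum_(T <- itrees k p.2) (nullity T)%:R = (size p.2)`!%:R * m (size p.2)].
  by case: p => a b /splits_perm_subseq[_ pa pb]; split; apply: IHk;
      rewrite ?sub_size ?sub_sorted.
pose n := size s.
have nS : (n.+1)`!%:R = n`!%:R * n.+1%:R :> R by rewrite factS mulnC natrM.
have c1 : \sum_(T <- itrees k.+1 (x :: s)) (1 : R) = n.+1`!%:R.
  rewrite sum_itreesS nS.
  transitivity (\sum_(p <- splits s) (size p.1)`!%:R * (size p.2)`!%:R * (1 : R)).
    apply: eq_big_seq => p /IHp[[a1 _ _] [b1 _ _]].
    rewrite mulr1 -a1 big_distrl /=; apply: eq_bigr => l _; by rewrite mul1r -b1.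
  rewrite (sum_splits (fun _ _ => 1)) sumr_const card_ord; by [].
have c2 : \sum_(T <- itrees k.+1 (x :: s)) (~~ exposed T)%:R = n.+1`!%:R * q n.+1.
  (* Pass to the complement: the root is exposed when neither child is, and for given label sets the
     two subtrees vary independently, which produces the convolution. *)
  have -> : n.+1`!%:R * q n.+1 = n.+1`!%:R - n`!%:R * \sum_(k < n.+1) q k * q (n - k)%N.
    by rewrite -qS nS; ring.
  rewrite -c1 -(sum_splits (fun a b => q a * q b)).
  under eq_bigr => T _.
    have -> : (~~ exposed T)%:R = 1 - (exposed T)%:R :> R by case: (exposed T);
        rewrite /= ?subr0 ?subrr.
    over.
  rewrite sumrB; congr (_ - _); rewrite sum_itreesS.
  apply: eq_big_seq => p /IHp[[_ a1 _] [_ b1 _]].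
  rewrite mulrACA -a1 -b1 big_distrl /=; apply: eq_bigr => l _.
  rewrite big_distrr /=; apply: eq_bigr => r _.
  by rewrite -natrM mulnb.
split=> //.
have -> : n.+1`!%:R * m n.+1 = n`!%:R * (\sum_(k < n.+1) (m k + m (n - k)%N)) + n.+1`!%:R * (1
    - 2 * q n.+1).
  have -> : \sum_(k < n.+1) (m k + m (n - k)%N) = 2 * \sum_(k < n.+1) m k.
    rewrite big_split /= mulr2n mulrDl mul1r; congr (_ + _).
    rewrite (reindex_inj rev_ord_inj) /=; apply: eq_bigr => i _.
    by rewrite subSS subKn // -ltnS.
  by rewrite nS -mulrA mS; ring.
rewrite -(sum_splits (fun a b => m a + m b)).
(* The contribution of the root, 1 or -1, is written as [1 - 2 * (~~ exposed _)%:R], so that the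
   first two sums evaluate it. *)
transitivity (\sum_(p <- splits s) \sum_(l <- itrees k p.1) \sum_(r <- itrees k p.2)
   ((nullity l)%:R + (nullity r)%:R + (1 - 2 * (~~ exposed (Node l x r))%:R : R))).
  rewrite sum_itreesS; apply: eq_big_seq => p ps; apply: eq_big_seq => l lin;
      apply: eq_big_seq => r rin.
  rewrite nullity_node; last first.
    case: p ps lin rin => a b /splits_perm_subseq[/= pab pa pb].
    rewrite !mem_itrees ?sub_size ?sub_sorted // => /andP[pl _] /andP[pr _].
    have plr : perm_eq (labels l ++ labels r) s.
      by apply: perm_trans pab; apply: perm_cat.
    rewrite (perm_mem plr) (perm_uniq plr) -[_ && _]/(uniq (x :: s)).
    by apply: (@sorted_uniq _ ltn) => //; [exact: ltn_trans | exact: ltnn].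
  by case: (exposed _); rewrite /= ?mulr0 ?mulr1; ring.
under eq_bigr => p _.
  under eq_bigr => l _ do rewrite big_split /=.
  rewrite big_split /=; over.
rewrite big_split /=; congr (_ + _).
  apply: eq_big_seq => p /IHp[[a1 _ a3] [b1 _ b3]].
  rewrite mulrDr; under eq_bigr => l _ do rewrite big_split /=.
  rewrite big_split /=; congr (_ + _).
    rewrite mulrAC -a3 -b1 big_distrl /=; apply: eq_bigr => l _.
    by rewrite big_distrr /=; apply: eq_bigr => r _; rewrite mulr1.
  rewrite -mulrA -b3 -a1 big_distrl /=; apply: eq_bigr => l _.
  by rewrite mul1r.
rewrite -(sum_itreesS (fun T => 1 - 2 * (~~ exposed T)%:R) k x s) sumrB -mulr_sumr c1 c2; ring.
Qed.

Lemma binary_increasing_itrees (n : nat) :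
  binary_increasing n = [set` itrees n (iota 1 n)].
Proof.
apply/seteqP; split=> T /=; rewrite mem_itrees ?size_iota ?iota_ltn_sorted //.
  by case=> -> ->.
by case/andP.
Qed.

Lemma mean_N0 (n : nat) : mean_binary_increasing n (fun T => (N0 R T)%:R) = m n.
Proof.
have sz : (size (iota 1 n) <= n)%N by rewrite size_iota.
have so := iota_ltn_sorted 1 n.
have ut := uniq_itrees sz so.
have [c1 _ c3] := sum_itrees sz so.
rewrite size_iota in c1 c3.
have card : (#|` fset_set (binary_increasing n)|)%:R = n`!%:R :> R.
  rewrite -c1 big_const_seq count_predT iter_addr_0; congr (_%:R).
  apply: perm_size; apply: uniq_perm => // T.
  rewrite in_fset_set; last exact: finite_binary_increasing.
  by rewrite binary_increasing_itrees mem_setE.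
rewrite /mean_binary_increasing card binary_increasing_itrees -fsbig_seq //.
rewrite (_ : \sum_(T <- _) _ = n`!%:R * m n).
  by rewrite mulrAC mulfV ?mul1r // pnatr_eq0 -lt0n fact_gt0.
rewrite -c3; apply: eq_big_seq => T; rewrite mem_itrees // => /andP[pT _].
by rewrite N0_nullity // (perm_uniq pT) iota_uniq.
Qed.

End Sums.

(** * Coefficients of powers of [1 - x] *)

Section Binomial.
Variable R : realType.

(* coefficient of x^n in (1 - x)^(t - 1) *)
Definition bcoef (n : nat) (t : R) : R := \prod_(i < n) (1 - t / i.+1%:R).

Lemma bcoef0 t : bcoef 0 t = 1. Proof. by rewrite /bcoef big_ord0. Qed.

Lemma bcoefS n t : n.+1%:R * bcoef n.+1 t = (n.+1%:R - t) * bcoef n t.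
Proof.
rewrite /bcoef big_ord_recr /= mulrCA mulrC; congr (_ * _).
by rewrite mulrBr mulr1 mulrCA mulfV ?mulr1 // pnatr_eq0.
Qed.

Lemma bcoef_at0 n : bcoef n 0 = 1.
Proof. by rewrite /bcoef big1 // => i _; rewrite mul0r subr0. Qed.

Lemma natS_inj n (a b : R) : n.+1%:R * a = n.+1%:R * b -> a = b.
Proof. by apply: mulfI; rewrite pnatr_eq0. Qed.

(** The product of [(1 - x)^(t - 1)] and [(1 - x)^(u - 1)] is [(1 - x)^(t + u - 2)]. *)
Lemma bcoef_vandermonde n t u :
  \sum_(j < n.+1) bcoef j t * bcoef (n - j)%N u = bcoef n (t + u - 1).
Proof.
elim: n => [|n IHn]; first by rewrite big_ord1 !bcoef0 mulr1.
apply: (@natS_inj n); rewrite bcoefS -IHn mulr_sumr.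
(* The factor [n + 1] is split as [j + (n + 1 - j)], so that [bcoefS] lowers one index in each
   half. *)
transitivity (\sum_(j < n.+2) (j%:R * bcoef j t) * bcoef (n.+1 - j)%N u
   + \sum_(j < n.+2) bcoef j t * ((n.+1 - j)%:R * bcoef (n.+1 - j)%N u)).
  rewrite -big_split /=; apply: eq_bigr => j _.
  have -> : n.+1%:R = j%:R + (n.+1 - j)%:R :> R by rewrite -natrD subnKC // -ltnS.
  ring.
rewrite big_ord_recl /= !mul0r add0r [X in _ + X]big_ord_recr /= subnn mul0r mulr0 addr0.
rewrite -big_split mulr_sumr /=; apply: eq_bigr => j _.
have jn : (j <= n)%N by rewrite -ltnS.
rewrite /bump /= add1n bcoefS subSS (subSn jn) bcoefS -!natr1 natrB //.
ring.
Qed.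

(** Partial sums correspond to division by [1 - x], the case [u = 0] above. *)
Lemma sum_bcoef n t : \sum_(j < n.+1) bcoef j t = bcoef n (t - 1).
Proof.
rewrite -[t in RHS]addr0 -bcoef_vandermonde.
by apply: eq_bigr => j _; rewrite bcoef_at0 mulr1.
Qed.

(** Coefficients of the derivative of [(1 - x)^(t - 1)]. *)
Lemma bcoef_deriv n t : n.+1%:R * bcoef n.+1 t = (1 - t) * bcoef n (t - 1).
Proof.
elim: n => [|n IHn]; first by rewrite bcoefS !bcoef0.
rewrite bcoefS; apply: (@natS_inj n).
rewrite mulrCA IHn.
transitivity ((1 - t) * (n.+1%:R * bcoef n.+1 (t - 1))); last by ring.
by rewrite bcoefS -(natr1 n.+1); ring.
Qed.

(** Coefficients after multiplication by [1 - x]. *)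
Lemma bcoef_shift n t : bcoef n.+1 (t + 1) = bcoef n.+1 t - bcoef n t.
Proof.
elim: n => [|n IHn].
  by apply: (@natS_inj 0); rewrite mulrBr !bcoefS !bcoef0; ring.
apply: (@natS_inj n.+1); rewrite bcoefS IHn [RHS]mulrBr bcoefS -(natr1 n.+1).
have := bcoefS n t; move: (bcoef n.+1 t) (bcoef n t) => x y E.
apply/eqP; rewrite -subr_eq0; apply/eqP.
transitivity (n.+1%:R * x - (n.+1%:R - t) * y); first by ring.
by rewrite E subrr.
Qed.

(* Induction on unit steps of t: by [bcoef_shift], one step multiplies the bound by
   [1 + W n / W n.+1]. *)
Lemma bcoef_growth (t0 growth : R) (W : nat -> R) :
  1 <= growth ->
  (forall n, 0 <= W n) ->
  (forall n, W n <= (growth - 1) * W n.+1) ->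
  (forall n t, t0 <= t <= t0 + 1 -> `|bcoef n t| <= W n) ->
  forall n t, t0 <= t -> `|bcoef n t| <= growth `^ (t - t0) * W n.
Proof.
move=> rho1 W0 WS base.
have rho0 : 0 <= growth by apply: le_trans rho1.
have step m : forall n t, t0 + m%:R <= t <= t0 + m%:R + 1 -> `|bcoef n t| <= growth ^+ m * W n.
  elim: m => [|m IHm] n t; first by rewrite addr0 expr0 mul1r; exact: base.
  rewrite -natr1 => /andP[t1 t2].
  have ht : t0 + m%:R <= t - 1 <= t0 + m%:R + 1 by apply/andP; split; lra.
  case: n => [|n].
    have : 1 <= W 0%N by have := base 0%N t0; rewrite bcoef0 normr1 lexx lerDl ler01; exact.
    by rewrite bcoef0 normr1 => h; apply: mulr_ege1 => //; exact: exprn_ege1.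
  rewrite -[t](subrK 1) bcoef_shift; apply: le_trans (ler_normB _ _) _.
  apply: le_trans (lerD (IHm n.+1 _ ht) (IHm n _ ht)) _.
  rewrite -mulrDr exprSr -mulrA ler_wpM2l ?exprn_ge0 //.
  by have := WS n; lra.
move=> n t tt0; set m := Num.truncn (t - t0).
have /andP[m1 m2] : m%:R <= t - t0 < m.+1%:R by apply: truncn_itv; rewrite subr_ge0.
apply: le_trans (step m n t _) _.
  by rewrite -natr1 in m2; apply/andP; split; lra.
apply: ler_wpM2r => //; rewrite -powR_mulrn //.
exact: ler_powR.
Qed.

End Binomial.

(** * Geometrically dominated series *)

Section GeometricSeries.
Variable R : realType.
Implicit Types u v F : nat -> R.

Definition geo_bounded (y : R) (u : nat -> R) := exists C, forall k, `|u k| <= C * y ^+ k.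

Definition sum_series (u : nat -> R) : R := limn (series u).

Lemma geo_bounded_cvg (y : R) u : 0 <= y < 1 -> geo_bounded y u ->
  series u @ \oo --> sum_series u.
Proof.
move=> /andP[y0 y1] [C uC]; apply: (@normed_cvg R R^o).
apply: (@series_le_cvg R _ (geometric C y)) => [k|k|k|].
- exact: normr_ge0.
- exact: le_trans (normr_ge0 _) (uC k).
- exact: uC.
- by apply: is_cvg_geometric_series; rewrite ger0_norm.
Qed.

Lemma series_cvg_unique u (a b : R) :
  series u @ \oo --> a -> series u @ \oo --> b -> a = b.
Proof. by move=> ua ub; rewrite -(cvg_lim _ ua) ?(cvg_lim _ ub). Qed.

Lemma series_cvg_sum u (l : R) : series u @ \oo --> l -> sum_series u = l.
Proof. by move=> h; apply: cvg_lim. Qed.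

Lemma series_cvg_lin (a b la lb : R) u v :
  series u @ \oo --> la -> series v @ \oo --> lb ->
  series (fun k => a * u k + b * v k) @ \oo --> a * la + b * lb.
Proof.
move=> ua vb.
rewrite (_ : series _ = (fun n => a * series u n + b * series v n)).
  by apply: cvgD; apply: cvgM => //; exact: cvg_cst.
by apply/funext => n; rewrite /series /= !mulr_sumr -big_split.
Qed.

Lemma series_cvg_sum_ord (n : nat) (u : nat -> nat -> R) (l : nat -> R) :
  (forall j, series (u j) @ \oo --> l j) ->
  series (fun k => \sum_(j < n) u j k) @ \oo --> \sum_(j < n) l j.
Proof.
move=> ul; elim: n => [|n IHn].
  rewrite big_ord0 (_ : series _ = cst 0); first exact: cvg_cst.
  by apply/funext => K; rewrite /series /= big1 // => k _; rewrite big_ord0.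
rewrite big_ord_recr /= -[X in X + _]mul1r -[X in _ + X]mul1r.
rewrite (_ : (fun k => _) = (fun k => 1 * (\sum_(j < n) u j k) + 1 * u n k)).
  exact: series_cvg_lin.
by apply/funext => k; rewrite big_ord_recr /= !mul1r.
Qed.

(** The left side replaces each of the first [k + 1] terms of the geometric series by the smallest
    one. *)
Lemma natmul_expr_le (x : R) (k : nat) : 0 <= x < 1 -> k.+1%:R * x ^+ k <= (1 - x)^-1.
Proof.
move=> /andP[x0 x1]; have x1' : 0 < 1 - x by lra.
rewrite -[leRHS]mul1r ler_pdivlMr // -mulrA.
have : \sum_(i < k.+1) x ^+ k <= \sum_(i < k.+1) x ^+ i.
  apply: ler_sum => i _; apply: ler_wiXn2l => //; [exact: ltW | by rewrite -ltnS].
rewrite sumr_const card_ord -mulr_natl => h.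
have := subrX1 x k.+1; have : 0 <= x ^+ k.+1 by apply: exprn_ge0.
move: h; move: (\sum_(i < _) _) => S h h1 h2; nra.
Qed.

Lemma geo_bounded_natmul (x : R) F : 0 <= x < 1 -> geo_bounded (x ^+ 3) F ->
  geo_bounded x (fun m => m.+1%:R * F m).
Proof.
move=> hx [C FC]; have [x0 x1] := andP hx.
have C0 : 0 <= C by have := le_trans (normr_ge0 _) (FC 0%N); rewrite expr0 mulr1.
exists (C * (1 - x)^-1) => k; rewrite normrM normr_nat.
apply: le_trans (ler_wpM2l _ (FC k)) _ => //.
rewrite -!mulrA mulrCA ler_wpM2l //.
have -> : x ^+ 3 ^+ k = x ^+ k * x ^+ k * x ^+ k by rewrite -exprM mulnC exprM exprS expr2
    mulrA.
rewrite !mulrA ler_wpM2r ?exprn_ge0 //.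
apply: le_trans (natmul_expr_le k hx); rewrite ler_piMr ?mulr_ge0 ?exprn_ge0 //.
by rewrite exprn_ile1 // ltW.
Qed.

Lemma sum_triangle F K :
  \sum_(k < K) \sum_(l < K - k) F (k + l)%N = \sum_(m < K) m.+1%:R * F m.
Proof.
elim: K => [|K IHK]; first by rewrite !big_ord0.
rewrite [RHS]big_ord_recr -IHK /= [LHS]big_ord_recr /= subSn // subnn big_ord1 addn0.
transitivity (\sum_(k < K) (\sum_(l < K - k) F (k + l)%N + F K) + F K).
  congr (_ + _); apply: eq_bigr => k _.
  by rewrite subSn ?(ltnW (ltn_ord k)) // big_ord_recr /= subnKC ?(ltnW (ltn_ord k)).
rewrite big_split /= sumr_const card_ord -addrA; congr (_ + _).
by rewrite -natr1 mulrDl mul1r mulr_natl.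
Qed.

(** Products of partial sums run over a square of index pairs. The triangle [k + l < K] gives the
    partial sum of the limit series by diagonals; the at most [K^2] remaining terms have index at
    least [K], and two of the three factors [x^K] absorb [K^2]. *)
Lemma cvg_square_sum (x : R) F : 0 <= x < 1 -> geo_bounded (x ^+ 3) F ->
  (fun K => \sum_(k < K) \sum_(l < K) F (k + l)%N) @ \oo -->
    sum_series (fun m => m.+1%:R * F m).
Proof.
move=> hx FB; have [x0 x1] := andP hx; have [C FC] := FB.
have C0 : 0 <= C by have := le_trans (normr_ge0 _) (FC 0%N); rewrite expr0 mulr1.
have cF := geo_bounded_cvg hx (geo_bounded_natmul hx FB).
have err K : `|\sum_(k < K) \sum_(l < K) F (k + l)%N - \sum_(m < K) m.+1%:R * F m|
    <= C * (1 - x)^-1 * (1 - x)^-1 * x ^+ K.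
  rewrite -sum_triangle -sumrB; apply: le_trans (ler_norm_sum _ _ _) _.
  have bnd (k : 'I_K) : `|\sum_(l < K) F (k + l)%N - \sum_(l < K - k) F (k + l)%N|
      <= K%:R * (C * x ^+ 3 ^+ K).
    rewrite -!(big_mkord xpredT (fun l => F (k + l)%N)).
    rewrite (@big_cat_nat _ _ _ (K - k)%N 0%N K) ?leq_subr //= [X in `|X|]addrAC subrr add0r.
    apply: le_trans (ler_norm_sum _ _ _) _.
    apply: (@le_trans _ _ (\sum_(K - k <= l < K) (C * x ^+ 3 ^+ K))).
      apply: ler_sum_nat => l /andP[l1 _]; apply: le_trans (FC _) _.
      rewrite ler_wpM2l // ler_wiXn2l ?exprn_ge0 ?exprn_ile1 ?(ltW x1) //.
      by rewrite -leq_subLR.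
    rewrite sumr_const_nat -[leLHS]mulr_natl ler_wpM2r ?ler_nat ?leq_subr //.
    by rewrite mulr_ge0 // !exprn_ge0.
  apply: le_trans (ler_sum _ (fun k _ => bnd k)) _.
  rewrite sumr_const card_ord -mulr_natl.
  have -> : x ^+ 3 ^+ K = x ^+ K * x ^+ K * x ^+ K by rewrite -exprM mulnC exprM exprS expr2
      mulrA.
  have Kx : K%:R * x ^+ K <= (1 - x)^-1.
    apply: le_trans (natmul_expr_le K hx).
    by rewrite ler_wpM2r ?exprn_ge0 // ler_nat.
  have xK : 0 <= x ^+ K by apply: exprn_ge0.
  have h : (K%:R * x ^+ K) * (K%:R * x ^+ K) <= (1 - x)^-1 * (1 - x)^-1.
    by apply: ler_pM => //; rewrite mulr_ge0.
  apply: (@le_trans _ _ (C * ((K%:R * x ^+ K) * (K%:R * x ^+ K)) * x ^+ K)).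
    by rewrite le_eqVlt; apply/orP; left; apply/eqP; ring.
  by rewrite ler_wpM2r // -[leRHS]mulrA ler_wpM2l.
have E0 : (fun K => C * (1 - x)^-1 * (1 - x)^-1 * x ^+ K) @ \oo --> (0 : R).
  by apply: cvg_geometric; rewrite ger0_norm.
rewrite (_ : (fun K => _) = (fun K => (\sum_(k < K) \sum_(l < K) F (k + l)%N
      - \sum_(m < K) m.+1%:R * F m) + series (fun m => m.+1%:R * F m) K)); last first.
  by apply/funext => K; rewrite /series /= big_mkord subrK.
rewrite -[X in _ --> X]add0r.
apply: cvgD => //.
apply: norm_cvg0; apply: (squeeze_cvgr _ (cvg_cst 0) E0).
by near=> K; rewrite normr_ge0 err.
Unshelve. all: by end_near. Qed.

End GeometricSeries.

(** * Decay of the coefficients *)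

Section Estimates.
Variable R : realType.

Definition sqrt5 : R := Num.sqrt 5.
(** Equal to [2 / (7 + 3 * sqrt5)], so the denominator in [C1] is the square of
    [(7 + 3 * sqrt5) * (1 - ratio * v^sqrt5)]. *)
Definition ratio : R := (7 - 3 * sqrt5) / 2.

Lemma sqrt5_sq : sqrt5 * sqrt5 = 5.
Proof. by rewrite -expr2 sqr_sqrtr. Qed.

Lemma sqrt5_ge0 : 0 <= sqrt5. Proof. exact: sqrtr_ge0. Qed.

Lemma le_sqrt5 (a : R) : 0 <= a -> (a <= sqrt5) = (a ^+ 2 <= 5).
Proof.
move=> a0; rewrite -(@ler_pXn2r _ 2%N) // ?nnegrE ?sqrt5_ge0 //.
by rewrite [sqrt5 ^+ 2]expr2 sqrt5_sq.
Qed.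

Lemma ge_sqrt5 (a : R) : 0 <= a -> (sqrt5 <= a) = (5 <= a ^+ 2).
Proof.
move=> a0; rewrite -(@ler_pXn2r _ 2%N) // ?nnegrE ?sqrt5_ge0 //.
by rewrite [sqrt5 ^+ 2]expr2 sqrt5_sq.
Qed.

(** Two consecutive convergents of the continued fraction of the square root of 5; the lower one
    gives the bound 5/34 on [ratio]. *)
Lemma sqrt5_bounds : 38 / 17 <= sqrt5 <= 161 / 72.
Proof. by rewrite le_sqrt5 ?ge_sqrt5; try apply/andP; try split; lra. Qed.

Lemma ratio_bounds : 0 < ratio <= 5 / 34.
Proof. by rewrite /ratio; have /andP[h1 h2] := sqrt5_bounds; apply/andP; split; lra. Qed.

(* The constants satisfy [(12 / 11) ^+ 3 <= growth - 1], so that [shifted_pow] below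
   is admissible in [bcoef_growth], and [ratio * growth `^ sqrt5 <= rate ^+ 3 < 1];
   two of the three factors [rate] absorb polynomial factors in k. *)
Definition growth : R := 23 / 10.
Definition rate : R := 99 / 100.

Lemma rate_itv : 0 <= rate < 1. Proof. by rewrite /rate; apply/andP; split; lra. Qed.

Lemma growth_ge1 : 1 <= growth. Proof. by rewrite /growth; lra. Qed.

Lemma growth_ge0 : 0 <= growth. Proof. by rewrite /growth; lra. Qed.

(** Since [sqrt5 <= 9 / 4], the fourth power of the inequality in [ratio_growth] reduces to this one
    between rationals. *)
Lemma growth_rate : (5 / 34) ^+ 4 * growth ^+ 9 <= rate ^+ 12.
Proof. by rewrite /growth /rate; lra. Qed.

Lemma ratio_growth : ratio * growth `^ sqrt5 <= rate ^+ 3.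
Proof.
have /andP[_ h2] := sqrt5_bounds; have /andP[r0 r1] := ratio_bounds.
have s94 : sqrt5 <= 9 / 4 by lra.
have /andP[x0 _] := rate_itv; have x3 := exprn_ge0 3 x0.
apply: (@le_trans _ _ (ratio * growth `^ (9 / 4))).
  by apply: ler_wpM2l; [exact: ltW | exact: ler_powR growth_ge1 _ _ s94].
have p0 := powR_ge0 growth (9 / 4).
rewrite -(@ler_pXn2r _ 4%N) ?nnegrE ?(mulr_ge0 (ltW r0) p0) //.
rewrite exprMn -(powR_mulrn 4 p0) -powRrM divfK ?pnatr_eq0 // (powR_mulrn 9 growth_ge0) -exprM.
apply: le_trans growth_rate.
apply: ler_wpM2r; first exact: exprn_ge0 growth_ge0.
by apply: lerXn2r; rewrite ?nnegrE ?(ltW r0) // divr_ge0.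
Qed.

Lemma ratio_growth_exp (k : nat) : ratio ^+ k * growth `^ (k%:R * sqrt5) <= rate ^+ 3 ^+ k.
Proof.
have /andP[r0 _] := ratio_bounds.
rewrite mulrC [k%:R * _]mulrC powRrM powR_mulrn ?powR_ge0 // -exprMn mulrC.
apply: lerXn2r; last exact: ratio_growth.
  by rewrite nnegrE mulr_ge0 ?powR_ge0 // ltW.
by rewrite nnegrE exprn_ge0 // /rate; lra.
Qed.

(** For such [t] each factor is at most [1 + 1 / (i + 1)], and the product of these telescopes. *)
Lemma bcoef_le_size (n : nat) (t : R) : -1 <= t <= -1 + 1 -> `|bcoef n t| <= n.+1%:R.
Proof.
move=> /andP[t1 t2]; elim: n => [|n IHn]; first by rewrite bcoef0 normr1.
have n0 : 0 < n.+1%:R :> R by rewrite ltr0n.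
have -> : n.+2%:R = n.+1%:R * (1 + n.+1%:R^-1) :> R.
  by rewrite mulrDr mulr1 mulfV ?gt_eqF // natr1.
rewrite /bcoef big_ord_recr /= normrM; apply: ler_pM => //.
have i0 : 0 < n.+1%:R^-1 :> R by rewrite invr_gt0.
move: (n.+1%:R^-1) i0 => i i0.
have h1 : 0 <= (t + 1) * i by apply: mulr_ge0; [lra | exact: ltW].
have h2 : 0 <= - t * i by apply: mulr_ge0; [lra | exact: ltW].
by rewrite ger0_norm; lra.
Qed.

(** Crude in [n], but enough for the convergence in [k] of the series at fixed [n]; decay in [n]
    comes from [bcoef_decay]. *)
Lemma bcoef_bound (n : nat) (t : R) : -1 <= t -> `|bcoef n t| <= growth `^ (t + 1) * n.+1%:R.
Proof.
move=> t1; rewrite -[X in t + X]opprK.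
apply: (@bcoef_growth R (-1) growth (fun n => n.+1%:R)) => //.
- by rewrite /growth; lra.
- move=> k; rewrite /growth -[k.+2%:R]natr1; have : 0 <= k.+1%:R :> R by []. lra.
- exact: bcoef_le_size.
Qed.

Lemma geo_bounded_bcoef (n : nat) (c : R) : -1 <= c <= 0 ->
  geo_bounded (rate ^+ 3) (fun k => ratio ^+ k * bcoef n (k%:R * sqrt5 + c)).
Proof.
move=> /andP[c1 c0]; have /andP[r0 _] := ratio_bounds.
exists (growth * n.+1%:R) => k; rewrite normrM ger0_norm ?exprn_ge0 ?(ltW r0) //.
have k0 : 0 <= k%:R * sqrt5 by rewrite mulr_ge0 ?sqrt5_ge0.
apply: le_trans (ler_wpM2l _ (bcoef_bound _ _)) _; [exact/exprn_ge0/ltW|lra|].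
have rho1 := growth_ge1; have rho0 := growth_ge0.
apply: (@le_trans _ _ (ratio ^+ k * (growth `^ (k%:R * sqrt5) * growth * n.+1%:R))).
  have -> : growth `^ (k%:R * sqrt5) * growth = growth `^ (k%:R * sqrt5 + 1).
    by rewrite powRD ?powRr1 //; apply/implyP => _; rewrite gt_eqF //; lra.
  rewrite ler_wpM2l ?exprn_ge0 ?(ltW r0) // ler_wpM2r //.
  by apply: ler_powR => //; lra.
have := ratio_growth_exp k; have : 0 <= growth * n.+1%:R by rewrite mulr_ge0.
move: (ratio ^+ k) (growth `^ _) (rate ^+ 3 ^+ k) => a b d.
move: (growth) (n.+1%:R) => f g h1 h2.
have := ler_wpM2l h1 h2; lra.
Qed.

(** The shift by 11 keeps the ratio of consecutive values below [(12 / 11)^3], also at small [n], as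
    [bcoef_growth] requires. *)
Definition shifted_pow (n : nat) : R := (n%:R + 11) `^ (- sqrt5).

Lemma shifted_pow_gt0 n : 0 < shifted_pow n.
Proof. by apply: powR_gt0; rewrite ltr_pwDr. Qed.

Lemma shifted_pow_le n : shifted_pow n <= (growth - 1) * shifted_pow n.+1.
Proof.
have /andP[h1 h2] := sqrt5_bounds.
have n0 : 0 <= n%:R :> R by [].
have p0 : 0 <= n%:R + 11 :> R by lra.
rewrite /shifted_pow !powRN -(natr1 n) ler_pdivlMr; last by rewrite powR_gt0 //; lra.
rewrite mulrC ler_pdivrMr; last by rewrite powR_gt0 //; lra.
apply: (@le_trans _ _ ((12 / 11 * (n%:R + 11)) `^ sqrt5)).
  by apply: ge0_ler_powR; rewrite ?nnegrE; lra.
have q0 : 0 <= 12 / 11 :> R by lra.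
rewrite (powRM _ q0 p0).
apply: ler_wpM2r; first exact: powR_ge0.
apply: (@le_trans _ _ ((12 / 11) `^ 3%:R)); first by apply: ler_powR; lra.
by rewrite powR_mulrn /growth; lra.
Qed.

(** From [exp x >= 1 + x] and [ln (1 + x) <= x], the quotient of consecutive values is at least
    [1 - sqrt5 / (n + 11)]. *)
Lemma shifted_pow_ratio (n : nat) : (1 - sqrt5 / n.+1%:R) * shifted_pow n <= shifted_pow n.+1.
Proof.
have /andP[h1 h2] := sqrt5_bounds.
have n0 : 0 <= n%:R :> R by [].
have p0 : 0 < n%:R + 11 :> R by lra.
have p1 : 0 < n%:R + 12 :> R by lra.
have -> : shifted_pow n.+1 = ((n%:R + 12) / (n%:R + 11)) `^ (- sqrt5) * shifted_pow n.
  rewrite /shifted_pow -powRM ?divr_ge0 ?ltW // -mulrA mulVf ?gt_eqF // mulr1 -(natr1 n).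
  by congr (_ `^ _); ring.
rewrite ler_pM2r ?shifted_pow_gt0 // /powR gt_eqF ?divr_gt0 //.
apply: le_trans (expR_ge1Dx _); rewrite lerD2l mulNr lerN2 ler_wpM2l ?sqrt5_ge0 //.
have -> : (n%:R + 12) / (n%:R + 11) = 1 + (n%:R + 11)^-1 :> R.
  apply: (@mulIf _ (n%:R + 11)); first by rewrite gt_eqF.
  by rewrite mulfVK ?gt_eqF // mulrDl mulVf ?gt_eqF //; ring.
apply: le_trans (le_ln1Dx _) _.
  have : 0 < (n%:R + 11)^-1 :> R by rewrite invr_gt0.
  lra.
by rewrite lef_pV2 ?posrE // -(natr1 n); lra.
Qed.

Lemma shifted_pow_decr (n : nat) : shifted_pow n.+1 <= shifted_pow n.
Proof.
have /andP[h1 h2] := sqrt5_bounds.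
have n0 : 0 <= n%:R :> R by [].
rewrite /shifted_pow !powRN lef_pV2 ?posrE ?powR_gt0 -?(natr1 n); try lra.
by apply: ge0_ler_powR; rewrite ?nnegrE; lra.
Qed.

(** Here [t < 4], so beyond index 3 the factors are nonnegative and at most [1 - sqrt5 / (n + 1)],
    which [shifted_pow_ratio] compares with [shifted_pow]. The first three factors are bounded by 5
    each. *)
Lemma bcoef_decay_unit (n : nat) (t : R) : sqrt5 <= t <= sqrt5 + 1 ->
  `|bcoef n t| <= 5 ^+ 3 / shifted_pow 3 * shifted_pow n.
Proof.
have /andP[h1 h2] := sqrt5_bounds.
move=> /andP[t1 t2].
have W3 := shifted_pow_gt0 3.
have c0 : 0 <= 5 ^+ 3 / shifted_pow 3 by rewrite divr_ge0 ?exprn_ge0 // ltW.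
have small k : (k <= 3)%N -> `|bcoef k t| <= 5 ^+ 3 /\ shifted_pow 3 <= shifted_pow k.
  move=> k3; split.
    apply: (@le_trans _ _ (5 ^+ k)).
      elim: k {k3} => [|k IHk]; first by rewrite bcoef0 normr1 expr0.
      rewrite /bcoef big_ord_recr /= normrM exprSr; apply: ler_pM => //.
      have i0 : 0 < k.+1%:R^-1 :> R by rewrite invr_gt0.
      have i1 : k.+1%:R^-1 <= 1 :> R by rewrite invf_le1 ?ler1n.
      move: (k.+1%:R^-1) i0 i1 => i i0 i1.
      have t0 : 0 <= t by lra.
      have := ler_wpM2l t0 i1; have := mulr_ge0 t0 (ltW i0).
      by move=> *; rewrite ler_norml; apply/andP; split; lra.
    by apply: ler_weXn2l => //; lra.
  case: k k3 => [|[|[|[|k]]]] // _.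
  - by apply: le_trans (shifted_pow_decr _) _;
      apply: le_trans (shifted_pow_decr _) (shifted_pow_decr _).
  - by apply: le_trans (shifted_pow_decr _) (shifted_pow_decr _).
  - exact: shifted_pow_decr.
have [n3|n3] := leqP n 3.
  have [b1 b2] := small n n3; apply: le_trans b1 _.
  by rewrite mulrAC ler_pdivlMr // ler_wpM2l // exprn_ge0.
elim: n n3 => [|n IHn] // n3.
have {}IHn : `|bcoef n t| <= 5 ^+ 3 / shifted_pow 3 * shifted_pow n.
  move: n3; rewrite ltnS leq_eqVlt => /predU1P[<-|]; last exact: IHn.
  by rewrite mulfVK ?gt_eqF //; have [] := small 3 isT.
have n4 : 4 <= n.+1%:R :> R by rewrite ler_nat.
have n0 : 0 < n.+1%:R :> R by lra.
rewrite /bcoef big_ord_recr /= normrM -/(bcoef n t).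
have d1 : 0 <= 1 - t / n.+1%:R by rewrite subr_ge0 ler_pdivrMr //; lra.
have d2 : 1 - t / n.+1%:R <= 1 - sqrt5 / n.+1%:R.
  by rewrite lerD2l lerN2 ler_wpM2r // invr_ge0 ltW.
rewrite (ger0_norm d1).
apply: (@le_trans _ _ (5 ^+ 3 / shifted_pow 3 * shifted_pow n * (1 - sqrt5 / n.+1%:R))).
  by apply: ler_pM.
by rewrite -mulrA; apply: ler_wpM2l => //; rewrite mulrC shifted_pow_ratio.
Qed.

Lemma bcoef_decay (n : nat) (t : R) : sqrt5 <= t ->
  `|bcoef n t| <= growth `^ (t - sqrt5) * (5 ^+ 3 / shifted_pow 3 * shifted_pow n).
Proof.
have /andP[h1 h2] := sqrt5_bounds.
apply: (@bcoef_growth R sqrt5 growth (fun n => 5 ^+ 3 / shifted_pow 3 * shifted_pow n)).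
- by rewrite /growth; lra.
- by move=> k; rewrite mulr_ge0 ?divr_ge0 ?exprn_ge0 ?(ltW (shifted_pow_gt0 _)).
- by move=> k; rewrite mulrCA ler_wpM2l ?shifted_pow_le // divr_ge0 ?exprn_ge0 ?(ltW
    (shifted_pow_gt0 _)).
- exact: bcoef_decay_unit.
Qed.

End Estimates.

(** * Explicit solution of the recurrences *)

Section Explicit.
Variable R : realType.
Notation s := (sqrt5 R).
Notation r := (ratio R).

Definition root_term (n k : nat) : R := r ^+ k * bcoef n (k%:R * s).
(** Both partial sums and convolutions over [n] of the root terms lead to these terms, by
    [sum_bcoef] and [bcoef_vandermonde]. *)
Definition shift_term (n k : nat) : R := r ^+ k * bcoef n (k%:R * s - 1).
(** The factor [c] solving [(1 - t) c = 2 c + (1 - t)] at [t = k * s]: this is the recurrence of the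
    mean for a single term, after [sum_bcoef] and [bcoef_deriv]. *)
Definition toll_coef (k : nat) : R := (k%:R * s - 1) / (k%:R * s + 1).
Definition toll_term (n k : nat) : R := r ^+ k * (toll_coef k * bcoef n (k%:R * s)).

Lemma sum_geometric_le (y : R) (K : nat) : 0 <= y < 1 ->
  \sum_(i < K) y ^+ i.+1 <= (1 - y)^-1.
Proof.
move=> /andP[y0 y1]; have y1' : 0 < 1 - y by lra.
rewrite -[leRHS]mul1r ler_pdivlMr //.
under eq_bigr => i _ do rewrite exprS.
rewrite -mulr_sumr.
have -> : y * (\sum_(i < K) y ^+ i) * (1 - y) = y * (1 - y ^+ K).
  by rewrite -[1 - y ^+ K]opprB subrX1; ring.
by have := mulr_ge0 y0 (exprn_ge0 K y0); lra.
Qed.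

Lemma mul_sqrt5_ge0 k : 0 <= k%:R * s :> R.
Proof. by rewrite mulr_ge0 ?sqrt5_ge0. Qed.

Lemma mul_sqrt5D1_gt0 k : 0 < k%:R * s + 1 :> R.
Proof. by have := mul_sqrt5_ge0 k; lra. Qed.

Lemma norm_toll_coef k : `|toll_coef k| <= 1.
Proof.
have k0 := mul_sqrt5_ge0 k; have k1 := mul_sqrt5D1_gt0 k.
rewrite /toll_coef normrM normfV (gtr0_norm k1) ler_pdivrMr // ler_norml.
by apply/andP; split; lra.
Qed.

Lemma rate3_itv : 0 <= rate R ^+ 3 < 1.
Proof.
have /andP[x0 x1] := rate_itv R.
by rewrite exprn_ge0 //= exprn_ilt1.
Qed.

Lemma root_term_bounded n : geo_bounded (rate R ^+ 3) (root_term n).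
Proof.
have h : -1 <= (0 : R) <= 0 by apply/andP; split; lra.
have [C HC] := geo_bounded_bcoef n h.
by exists C => k; have := HC k; rewrite addr0.
Qed.

Lemma shift_term_bounded n : geo_bounded (rate R ^+ 3) (shift_term n).
Proof. by apply: geo_bounded_bcoef; apply/andP; split; lra. Qed.

Lemma toll_term_bounded n : geo_bounded (rate R ^+ 3) (toll_term n).
Proof.
have [C HC] := root_term_bounded n; exists C => k; apply: le_trans (HC k).
rewrite /toll_term mulrCA normrM -[leRHS]mul1r.
by apply: ler_wpM2r => //; exact: norm_toll_coef.
Qed.

Lemma cvg_root_term n : series (root_term n) @ \oo --> sum_series (root_term n).
Proof. exact: geo_bounded_cvg rate3_itv (root_term_bounded n). Qed.

Lemma cvg_shift_term n : series (shift_term n) @ \oo --> sum_series (shift_term n).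
Proof. exact: geo_bounded_cvg rate3_itv (shift_term_bounded n). Qed.

Lemma cvg_toll_term n : series (toll_term n) @ \oo --> sum_series (toll_term n).
Proof. exact: geo_bounded_cvg rate3_itv (toll_term_bounded n). Qed.

Definition phi : R := (1 + s) / 2.
Definition cover_prob (n : nat) : R := - phi + s * sum_series (root_term n).
(** The homogeneous recurrence of the mean is solved by multiples of [n + 1]; this multiple makes
    the mean vanish at 0. *)
Definition C1_series : R := 2 + s + 2 * s * sum_series (toll_term 0).
Definition mean_nullity (n : nat) : R :=
  C1_series * n.+1%:R - s - 2 - 2 * s * sum_series (toll_term n).

Lemma sum_ratio : sum_series (root_term 0) = (1 - r)^-1.
Proof.
apply: series_cvg_sum.
rewrite (_ : root_term 0 = geometric 1 r); last first.
  by apply/funext => k; rewrite /root_term bcoef0 mulr1 /geometric /= mul1r.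
rewrite -[(1 - r)^-1]mul1r; apply: cvg_geometric_series.
have /andP[r0 r1] := ratio_bounds R.
by rewrite gtr0_norm //; lra.
Qed.

(** This initial value determines [ratio]: it amounts to [1 - r = 2 s / (3 + s)]. *)
Lemma cover_prob0 : cover_prob 0 = 1.
Proof.
have ss := sqrt5_sq R; have /andP[r0 r1] := ratio_bounds R.
rewrite /cover_prob sum_ratio /phi.
have r1' : 1 - r != 0 by rewrite gt_eqF //; lra.
apply: (@mulIf _ (1 - r)) => //.
rewrite mulrDl (mulfVK r1') mul1r /ratio; move: ss; move: (s) => t ss.
by lra.
Qed.

Lemma sum_root_term n : \sum_(j < n.+1) sum_series (root_term j) = sum_series (shift_term n).
Proof.
rewrite -(series_cvg_sum (@series_cvg_sum_ord _ n.+1 _ _ cvg_root_term)).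
congr sum_series; apply/funext => k.
by rewrite -mulr_sumr sum_bcoef.
Qed.

(** Vandermonde merges the terms [k] and [l] into one depending on [k + l] only, and each index [k]
    arises from [k + 1] pairs. *)
Lemma conv_root_term n :
  \sum_(j < n.+1) sum_series (root_term j) * sum_series (root_term (n - j)%N)
    = sum_series (fun k => k.+1%:R * shift_term n k).
Proof.
have h1 := cvg_square_sum (rate_itv R) (shift_term_bounded n).
have h2 : (fun K => \sum_(j < n.+1) series (root_term j) K * series (root_term (n - j)%N) K) @
    \oo
    --> \sum_(j < n.+1) sum_series (root_term j) * sum_series (root_term (n - j)%N).
  by apply: cvg_big => [|j _]; [exact: add_continuous | apply: cvgM; exact: cvg_root_term].
apply: (@cvg_unique _ _ _ _ _ _ h2); first exact: norm_hausdorff.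
rewrite (_ : (fun K => _) = (fun K => \sum_(k < K) \sum_(l < K) shift_term n (k + l)%N)) //.
apply/funext => K.
under eq_bigr => j _.
  rewrite /series /= !big_mkord big_distrl /=.
  under eq_bigr => k _ do rewrite big_distrr /=.
  over.
rewrite exchange_big; apply: eq_bigr => k _.
rewrite exchange_big; apply: eq_bigr => l _.
rewrite /root_term /shift_term natrD mulrDl -bcoef_vandermonde mulr_sumr.
by apply: eq_bigr => j _; rewrite exprD; ring.
Qed.

Lemma cover_probS n :
  n.+1%:R * (1 - cover_prob n.+1) = \sum_(k < n.+1) cover_prob k * cover_prob (n - k)%N.
Proof.
have ss := sqrt5_sq R.
have cF := @cvg_shift_term n.
have cG := @geo_bounded_cvg R _ _ (rate_itv R) (geo_bounded_natmul (rate_itv R)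
    (shift_term_bounded n)).
(* Termwise this is [bcoef_deriv] with [1 - k s = (1 + s) - s (k + 1)], which brings in the series
   of the convolution. *)
have eU : n.+1%:R * sum_series (root_term n.+1) =
    (1 + s) * sum_series (shift_term n) + (- s) * sum_series (fun k => k.+1%:R * shift_term n
        k).
  have c1 := @series_cvg_lin _ n.+1%:R 0 _ _ _ _ (@cvg_root_term n.+1) (@cvg_root_term n.+1).
  have c2 := @series_cvg_lin _ (1 + s) (- s) _ _ _ _ cF cG.
  rewrite mul0r addr0 in c1; apply: series_cvg_unique c2.
  rewrite (_ : (fun k => _) = (fun k => n.+1%:R * root_term n.+1 k + 0 * root_term n.+1 k)) //.
  apply/funext => k; rewrite mul0r addr0 /root_term [RHS]mulrCA bcoef_deriv /shift_term
      -(natr1 k); ring.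
have rev : \sum_(k < n.+1) sum_series (root_term (n - k)%N) = sum_series (shift_term n).
  rewrite -sum_root_term [RHS](reindex_inj rev_ord_inj) /=.
  by apply: eq_bigr => k _; rewrite subSS.
have -> : \sum_(k < n.+1) cover_prob k * cover_prob (n - k)%N =
    n.+1%:R * (phi * phi) - phi * s * sum_series (shift_term n) - phi * s * sum_series
        (shift_term n)
      + s * s * sum_series (fun k => k.+1%:R * shift_term n k).
  rewrite -conv_root_term -[in X in X - _ + _]sum_root_term -rev.
  have -> : n.+1%:R * (phi * phi) = \sum_(k < n.+1) phi * phi.
    by rewrite sumr_const card_ord mulr_natl.
  rewrite !mulr_sumr -!sumrB -big_split /=; apply: eq_bigr => k _.
  rewrite /cover_prob; ring.
rewrite ss /cover_prob.
have -> : n.+1%:R * (1 - (- phi + s * sum_series (root_term n.+1))) =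
   n.+1%:R * (1 + phi) - s * (n.+1%:R * sum_series (root_term n.+1)) by ring.
rewrite eU; move: (sum_series (fun k => k.+1%:R * shift_term n k)) (sum_series (shift_term n))
    (n.+1%:R) => b a c.
(* [phi] is the golden ratio; this equation matches the constant terms of the two sides. *)
have -> : phi * phi = 1 + phi.
  have : (1 + s) * (1 + s) = 2 * s + 1 + s * s by ring.
  by rewrite ss /phi => h; lra.
have -> : phi * s = (s + 5) / 2 by rewrite /phi -ss; field.
have -> : s * ((1 + s) * a + (- s) * b) = (s + s * s) * a - (s * s) * b by ring.
by rewrite ss; field.
Qed.

Lemma mean_nullity0 : mean_nullity 0 = 0.
Proof. rewrite /mean_nullity /C1_series; ring. Qed.

Lemma sum_succ n : 2 * (\sum_(k < n.+1) k.+1%:R) = n.+1%:R * n.+2%:R :> R.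
Proof.
elim: n => [|n IHn]; first by rewrite big_ord1 mulrC.
by rewrite big_ord_recr /= mulrDr IHn -mulrDl -natrD addnC mulrC.
Qed.

(** The three parts balance separately: [n + 1] solves the homogeneous equation, the constant
    [- s - 2] absorbs [1 + 2 phi = s + 2], and the toll terms match the series in [cover_prob]. *)
Lemma mean_nullityS n : n.+1%:R * mean_nullity n.+1
  = 2 * (\sum_(k < n.+1) mean_nullity k) + n.+1%:R * (1 - 2 * cover_prob n.+1).
Proof.
have cV := @series_cvg_sum_ord R n.+1 _ _ (@cvg_toll_term).
have eV : n.+1%:R * sum_series (toll_term n.+1) =
   2 * \sum_(j < n.+1) sum_series (toll_term j) + n.+1%:R * sum_series (root_term n.+1).
  have c1 := @series_cvg_lin _ n.+1%:R 0 _ _ _ _ (@cvg_toll_term n.+1) (@cvg_toll_term n.+1).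
  have c2 := @series_cvg_lin _ 2 n.+1%:R _ _ _ _ cV (@cvg_root_term n.+1).
  rewrite mul0r addr0 in c1; apply: series_cvg_unique c2.
  rewrite (_ : (fun k => _) = (fun k => n.+1%:R * toll_term n.+1 k + 0 * toll_term n.+1 k)) //.
  apply/funext => k; rewrite mul0r addr0 /toll_term /root_term -!mulr_sumr sum_bcoef.
  rewrite [RHS]mulrCA [X in _ = _ * X]mulrCA bcoef_deriv.
  rewrite [X in _ + X]mulrCA bcoef_deriv /toll_coef.
  have := mul_sqrt5D1_gt0 k; move: (k%:R * s) (r ^+ k) => t a t1.
  move: (bcoef n (t - 1)) => b.
  by field; rewrite gt_eqF.
have -> : \sum_(k < n.+1) mean_nullity k = C1_series * (\sum_(k < n.+1) k.+1%:R)
   - n.+1%:R * (s + 2) - 2 * s * \sum_(j < n.+1) sum_series (toll_term j).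
  have -> : n.+1%:R * (s + 2) = \sum_(k < n.+1) (s + 2).
    by rewrite sumr_const card_ord mulr_natl.
  rewrite !mulr_sumr -!sumrB; apply: eq_bigr => k _.
  rewrite /mean_nullity; ring.
have h := sum_succ n.
have -> : 2 * (C1_series * (\sum_(k < n.+1) k.+1%:R)
   - n.+1%:R * (s + 2) - 2 * s * \sum_(j < n.+1) sum_series (toll_term j))
   = C1_series * (2 * (\sum_(k < n.+1) k.+1%:R)) - 2 * n.+1%:R * (s + 2)
     - 2 * s * (2 * \sum_(j < n.+1) sum_series (toll_term j)) by ring.
rewrite h.
have -> : 2 * \sum_(j < n.+1) sum_series (toll_term j) =
   n.+1%:R * sum_series (toll_term n.+1) - n.+1%:R * sum_series (root_term n.+1) by rewrite eV
       addrK.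
by rewrite /mean_nullity /cover_prob /phi; field.
Qed.

(** The toll term [k = 0] is -1 and contributes [2 s], turning the constant [- s - 2] into [s - 2].
    All later terms have [k s >= s], hence decay like [shifted_pow], with geometrically summable
    factors. *)
Lemma mean_nullity_asymp : exists A : R, 0 <= A /\ forall n,
  `|mean_nullity n - (C1_series * n.+1%:R + s - 2)| <= A * shifted_pow R n.
Proof.
have /andP[h1 h2] := sqrt5_bounds R; have s0 := sqrt5_ge0 R.
have /andP[r0 r1] := ratio_bounds R.
have /andP[x0 x1] := rate3_itv.
have [B [B0 decay]] : exists B : R, 0 <= B /\ forall n (t : R), s <= t ->
    `|bcoef n t| <= growth R `^ (t - s) * (B * shifted_pow R n).
  exists (5 ^+ 3 / shifted_pow R 3); split; last exact: bcoef_decay.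
  by rewrite divr_ge0 ?exprn_ge0 // ltW // shifted_pow_gt0.
have term n k : `|toll_term n k.+1| <= B * shifted_pow R n * rate R ^+ 3 ^+ k.+1.
  have ks : s <= k.+1%:R * s by rewrite ler_peMl // ler1n.
  rewrite /toll_term 2!normrM (ger0_norm (exprn_ge0 _ (ltW r0))).
  apply: (@le_trans _ _ (r ^+ k.+1 * (growth R `^ (k.+1%:R * s) * (B * shifted_pow R n)))).
    apply: ler_wpM2l; first exact/exprn_ge0/ltW.
    apply: (@le_trans _ _ (1 * `|bcoef n (k.+1%:R * s)|)).
      by apply: ler_wpM2r; [exact: normr_ge0 | exact: (norm_toll_coef k.+1)].
    rewrite mul1r; apply: le_trans (decay n _ ks) _.
    apply: ler_wpM2r; first by rewrite mulr_ge0 // ltW // shifted_pow_gt0.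
    by apply: ler_powR; [exact: growth_ge1 | rewrite lerBlDr lerDl].
  rewrite mulrA [leRHS]mulrC; apply: ler_wpM2r; last exact: ratio_growth_exp.
  by rewrite mulr_ge0 // ltW // shifted_pow_gt0.
exists (2 * s * (B * (1 - rate R ^+ 3)^-1)); split.
  have i0 : 0 <= (1 - rate R ^+ 3)^-1 by rewrite invr_ge0 subr_ge0 ltW.
  exact: mulr_ge0 (mulr_ge0 _ s0) (mulr_ge0 B0 i0).
move=> n.
have -> : mean_nullity n - (C1_series * n.+1%:R + s - 2) =
    - (2 * s * (sum_series (toll_term n) + 1)).
  by rewrite /mean_nullity; ring.
rewrite normrN normrM ger0_norm ?mulr_ge0 // -!mulrA ler_wpM2l //; apply: ler_wpM2l => //.
have v0 : toll_term n 0 = -1.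
  by rewrite /toll_term /toll_coef mul0r expr0 bcoef_at0 sub0r add0r divr1 !mul1r mulr1.
have part K : `|series (toll_term n) K.+1 + 1| <= B * ((1 - rate R ^+ 3)^-1 * shifted_pow R n).
  rewrite /series /= big_mkord big_ord_recl /= v0 addrAC addNr add0r.
  apply: le_trans (ler_norm_sum _ _ _) _.
  apply: (@le_trans _ _ (\sum_(k < K) B * shifted_pow R n * rate R ^+ 3 ^+ k.+1)).
    by apply: ler_sum => k _; exact: term.
  rewrite -mulr_sumr -mulrA ler_wpM2l // mulrC ler_wpM2r ?(ltW (shifted_pow_gt0 _ n)) //.
  exact: sum_geometric_le rate3_itv.
have cv : (fun K => `|series (toll_term n) K.+1 + 1|) @ \oo --> `|sum_series (toll_term n) + 1|.
  apply: cvg_norm; apply: cvgD; last exact: cvg_cst.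
  by have := @cvg_toll_term n; rewrite -(cvg_shiftS (series (toll_term n))).
rewrite -(cvg_lim _ cv) //; apply: limr_le; first by apply/cvg_ex; eexists; exact: cv.
by near=> K; exact: part.
Unshelve. all: by end_near. Qed.

End Explicit.

(** * The constant [C1] *)

Section PowerIntegrals.
Variable R : realType.
Notation mu := (@lebesgue_measure R).

Lemma powR_LRcontinuous (a : R) : 0 < a ->
  derivable_oo_LRcontinuous (fun v : R => v `^ a) 0 1.
Proof.
move=> a0; split.
- move=> x; rewrite in_itv /= => /andP[x0 _].
  by apply: derivable_powR; rewrite in_itv /= x0.
- by rewrite powR0 ?gt_eqF //; exact: powR_cvg0.
- apply: cvg_at_left_filter.
  have : {for (1 : R), continuous (fun v : R => v `^ a)}; last by exact.
  apply: differentiable_continuous; apply/derivable1_diffP.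
  by apply: derivable_powR; rewrite in_itv /= ltr01.
Qed.

Lemma powR_within_continuous (a : R) : 0 <= a ->
  {within `[0, 1], continuous (fun v : R => v `^ a)}.
Proof.
(* At exponent 0 the function is constantly 1, also at the point 0. *)
rewrite le_eqVlt => /predU1P[<-|a0].
  rewrite (_ : (fun v : R => v `^ 0) = cst 1); first exact: cst_continuous.
  by apply/funext => v; rewrite powRr0.
exact: derivable_oo_LRcontinuous_within (powR_LRcontinuous a0).
Qed.

Lemma within_integrable (f : R -> R) : {within `[0, 1], continuous f} ->
  mu.-integrable `[0, 1] (EFin \o f).
Proof. by move=> cf; apply: continuous_compact_integrable => //; exact: segment_compact. Qed.

Lemma Rintegral_powR (a : R) : 0 <= a ->
  \int[mu]_(v in `[0, 1]) (v `^ a) = (a + 1)^-1.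
Proof.
move=> a0; have a1 : 0 < a + 1 by lra.
rewrite /Rintegral.
rewrite (@continuous_FTC2 R _ (fun v : R => (a + 1)^-1 * v `^ (a + 1))) //=.
- by rewrite powR1 mulr1 powR0 ?gt_eqF // mulr0 subr0.
- exact: powR_within_continuous.
- have [d l r] := powR_LRcontinuous a1; split.
  + by move=> x hx; apply: derivableM => //; exact: d.
  + by apply: cvgM => //; exact: cvg_cst.
  + by apply: cvgM => //; exact: cvg_cst.
- move=> x; rewrite in_itv /= => /andP[x0 _].
  rewrite derive1E deriveM //; last by apply: derivable_powR; rewrite in_itv /= x0.
  rewrite derive_cst scaler0 addr0 -derive1E powR_derive1 ?in_itv /= ?x0 //.
  by rewrite /GRing.scale /= mulrA mulVf ?gt_eqF // mul1r addrK.
Qed.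

Lemma powR_sum_within_continuous (s a : R) (c : nat -> R) (K : nat) : 0 <= s ->
  {within `[0, 1], continuous (fun v : R => a + \sum_(k < K) c k * v `^ (k%:R * s))}.
Proof.
move=> s0; apply/subspace_continuousP => x x01.
apply: cvgD; first exact: cvg_cst.
apply: cvg_big => [|k _]; first exact: add_continuous.
apply: cvgM; first exact: cvg_cst.
have ks : 0 <= k%:R * s by rewrite mulr_ge0.
by have /subspace_continuousP := powR_within_continuous ks; apply.
Qed.

Lemma Rintegral_powR_sum (s a : R) (c : nat -> R) (K : nat) : 0 <= s ->
  \int[mu]_(v in `[0, 1]) (a + \sum_(k < K) c k * v `^ (k%:R * s))
    = a + \sum_(k < K) c k * (k%:R * s + 1)^-1.
Proof.
move=> s0; elim: K => [|K IHK].
  under eq_Rintegral => v _ do rewrite big_ord0 addr0.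
  rewrite big_ord0 addr0 Rintegral_cst //= lebesgue_measure_itv /= lte01.
  by rewrite sube0 /= mulr1.
under eq_Rintegral => v _ do rewrite big_ord_recr /= addrA.
have ks : 0 <= K%:R * s by rewrite mulr_ge0.
rewrite RintegralD //; last 2 first.
- by apply: within_integrable; exact: powR_sum_within_continuous.
- apply: within_integrable; apply/subspace_continuousP => x x01.
  apply: cvgM; first exact: cvg_cst.
  by have /subspace_continuousP := powR_within_continuous ks; apply.
rewrite IHK RintegralZl //; last by apply: within_integrable; exact: powR_within_continuous.
by rewrite Rintegral_powR // big_ord_recr /= addrA.
Qed.

End PowerIntegrals.

(** * Expansion of [C1] in powers of [ratio] *)

Section Constant.
Variable R : realType.
Notation s := (sqrt5 R).
Notation r := (ratio R).
Notation mu := (@lebesgue_measure R).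

Definition C1_partial (K : nat) : R := 2 + s + 2 * s * \sum_(k < K) r ^+ k * toll_coef R k.

Lemma sum_arith_geo (y t : R) (K : nat) :
  (\sum_(k < K) (k%:R * t - 1) * y ^+ k) * (1 - y) ^+ 2
    = t * y - (1 - y) - y ^+ K * ((K%:R * t - 1) * (1 - y) + t * y).
Proof.
elim: K => [|K IHK]; first by rewrite big_ord0 expr0 mul0r mul0r; ring.
rewrite big_ord_recr /= mulrDl IHK [y ^+ K.+1]exprS -(natr1 K); ring.
Qed.

Definition integrand (v : R) : R :=
  ((8 + 4 * s) * v `^ (2 * s) + (84 + 36 * s) * v `^ s - (22 + 10 * s))
    / (7 + 3 * s - 2 * v `^ s) ^+ 2.

Lemma powR_itv (v : R) : 0 <= v <= 1 -> 0 <= v `^ s <= 1.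
Proof.
move=> /andP[v0 v1]; rewrite powR_ge0 /=.
have : v `^ s <= 1 `^ s by apply: ge0_ler_powR; rewrite ?nnegrE ?sqrt5_ge0.
by rewrite powR1.
Qed.

Lemma denom_gt0 (v : R) : 0 <= v <= 1 -> 0 < 7 + 3 * s - 2 * v `^ s.
Proof. by move=> /powR_itv/andP[_ w1]; have := sqrt5_ge0 R; lra. Qed.

Definition integrand_partial (K : nat) (v : R) : R :=
  2 + s + \sum_(k < K) (2 * s * (k%:R * s - 1) * r ^+ k) * v `^ (k%:R * s).

(** With [y = r v^s] the integrand is [2 + s + 2 s (s y - (1 - y)) / (1 - y)^2], the sum of an
    arithmetico-geometric series. [sum_arith_geo] gives the remainder [2 s Q / (1 - y)^2] exactly,
    and it is nonnegative once [K >= 1]. *)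
Lemma integrand_bounds (K : nat) (v : R) : (0 < K)%N -> 0 <= v <= 1 ->
  integrand_partial K v <= integrand v <= integrand_partial K v + 14 * K%:R * r ^+ K.
Proof.
move=> K0 v01; set p := integrand_partial K v; have [v0 v1] := andP v01.
have /andP[r0 r1] := ratio_bounds R; have /andP[s1 s2] := sqrt5_bounds R; have ss := sqrt5_sq R.
have /andP[w0 w1] := powR_itv v01; have d0 := denom_gt0 v01.
set w := v `^ s in w0 w1 d0 *; set D := 7 + 3 * s.
pose y := r * w.
have Dy : D * y = 2 * w.
  have : D * r = 2 by rewrite /D /ratio; move: (s) ss => t tt; lra.
  by rewrite /y mulrA => ->.
have y0 : 0 <= y by rewrite mulr_ge0 // ltW.
have yr : y <= r by rewrite ler_piMr // ltW.
have y1 : 0 < 1 - y by lra.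
have pE : p = 2 + s + 2 * s * \sum_(k < K) (k%:R * s - 1) * y ^+ k.
  rewrite /p /integrand_partial; congr (_ + _); rewrite mulr_sumr; apply: eq_bigr => k _.
  rewrite (mulrC k%:R s) powRrM powR_mulrn ?powR_ge0 // -/w /y [(r * w) ^+ k]exprMn; ring.
have D0 : 0 < D by rewrite /D; lra.
set Q := y ^+ K * ((K%:R * s - 1) * (1 - y) + s * y).
have IE : integrand v = p + 2 * s * Q / (1 - y) ^+ 2.
  have -> : integrand v = (2 + s) + 2 * s * (s * y - (1 - y)) / (1 - y) ^+ 2.
    have v2 : v `^ (2 * s) = w ^+ 2 by rewrite mulrC powRrM powR_mulrn ?powR_ge0.
    have dE : D - 2 * w = D * (1 - y) by rewrite -Dy; ring.
    rewrite /integrand v2 -/w -/D dE.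
    apply: (@mulIf _ ((D * (1 - y)) ^+ 2)); first by rewrite expf_neq0 // gt_eqF // mulr_gt0.
    rewrite divfK; last by rewrite expf_neq0 // gt_eqF // mulr_gt0.
    have y1n : 1 - y != 0 by rewrite gt_eqF.
    have -> : (2 + s + 2 * s * (s * y - (1 - y)) / (1 - y) ^+ 2) * (D * (1 - y)) ^+ 2
      = (2 + s) * (D * (1 - y)) ^+ 2 + 2 * s * D * (s * (D * y) - D * (1 - y)) by field.
    rewrite -dE Dy /D; move: (w) (s) ss => u t tt.
    have tu : t * t * u = 5 * u by rewrite tt.
    have ttt : t * t * t = 5 * t by rewrite tt.
    have ttu : t * t * u ^+ 2 = 5 * u ^+ 2 by rewrite tt.
    have tttu : t * t * t * u = 5 * t * u by rewrite tt.
    by lra.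
  rewrite pE -[RHS]addrA; congr (_ + _).
  have yn2 : (1 - y) ^+ 2 != 0 by rewrite expf_neq0 // gt_eqF.
  apply: (@mulIf _ ((1 - y) ^+ 2)) => //.
  rewrite [RHS]mulrDl !(divfK yn2) -[X in _ = X + _]mulrA sum_arith_geo -/Q; ring.
have Ks : s <= K%:R * s by rewrite ler_peMl ?sqrt5_ge0 // ler1n.
have K1 : 1 <= K%:R :> R by rewrite ler1n.
have yK : 0 <= y ^+ K <= r ^+ K.
  by rewrite exprn_ge0 //= lerXn2r // nnegrE // ltW.
have Q0 : 0 <= (K%:R * s - 1) * (1 - y) + s * y.
  by apply: addr_ge0; apply: mulr_ge0; lra.
have Q1 : (K%:R * s - 1) * (1 - y) + s * y <= K%:R * s.
  have : 0 <= (K%:R * s - s) * y by apply: mulr_ge0; lra.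
  lra.
have [yK0 yK1] := andP yK.
have QQ : 0 <= Q <= r ^+ K * (K%:R * s).
  by rewrite mulr_ge0 //= ler_pM.
(* [y <= r <= 5 / 34] gives [1 - y >= 29 / 34]; the constant 14 then bounds [10 (34 / 29)^2]. *)
have inv0 : 0 <= ((1 - y) ^+ 2)^-1 <= (34 / 29) ^+ 2.
  have a1 : 0 < 29 / 34 :> R by lra.
  have a2 : 29 / 34 <= 1 - y by lra.
  rewrite invr_ge0 exprn_ge0 ?(ltW y1) //= -exprVn.
  have -> : 34 / 29 = (29 / 34)^-1 :> R by rewrite invf_div.
  by rewrite lerXn2r ?nnegrE ?invr_ge0 ?(ltW y1) ?(ltW a1) // lef_pV2 ?posrE.
have [i0 i1] := andP inv0; have [q0 q1] := andP QQ.
rewrite IE lerDl lerD2l; apply/andP; split.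
  by rewrite !mulr_ge0 ?sqrt5_ge0.
apply: (@le_trans _ _ (2 * s * (r ^+ K * (K%:R * s)) * (34 / 29) ^+ 2)).
  apply: ler_pM => //; first by rewrite !mulr_ge0 ?sqrt5_ge0.
  by apply: ler_wpM2l => //; rewrite mulr_ge0 ?sqrt5_ge0.
have -> : 2 * s * (r ^+ K * (K%:R * s)) * (34 / 29) ^+ 2 =
   (2 * 5 * (34 / 29) ^+ 2) * (K%:R * r ^+ K) by rewrite -ss; ring.
rewrite -[leRHS]mulrA; apply: ler_wpM2r; last by clear; lra.
by rewrite mulr_ge0 // exprn_ge0 // ltW.
Qed.

Lemma integrand_within_continuous : {within `[0, 1], continuous integrand}.
Proof.
apply/subspace_continuousP => x x01.
have x01' : 0 <= x <= 1 by move: x01; rewrite /= in_itv.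
have cw a : 0 <= a -> (fun v : R => v `^ a) @ within `[0, 1] (nbhs x) --> x `^ a.
  by move=> a0; have /subspace_continuousP := powR_within_continuous a0; apply.
have s0 := sqrt5_ge0 R.
have s20 : 0 <= 2 * s by rewrite mulr_ge0.
rewrite /integrand; apply: cvgM.
  apply: cvgB; last exact: cvg_cst.
  apply: cvgD; apply: cvgM; [exact: cvg_cst | exact: cw | exact: cvg_cst | exact: cw].
apply: cvgV; first by rewrite expf_neq0 // gt_eqF // denom_gt0.
apply: cvgM; (apply: cvgB; [exact: cvg_cst | apply: cvgM; [exact: cvg_cst | exact: cw]]).
Qed.

Lemma C1_bounds (K : nat) : (0 < K)%N ->
  C1_partial K <= C1 R <= C1_partial K + 14 * K%:R * r ^+ K.
Proof.
move=> K0; set e := 14 * K%:R * r ^+ K.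
have s0 := sqrt5_ge0 R.
have C1E : C1 R = \int[mu]_(v in `[0, 1]) integrand v by [].
(* The constant [a] is left free: the upper bound uses it with the error [e] added, as the interval
   has length 1. *)
have PE a : a + 2 * s * \sum_(k < K) r ^+ k * toll_coef R k
    = \int[mu]_(v in `[0, 1])
        (a + \sum_(k < K) (2 * s * (k%:R * s - 1) * r ^+ k) * v `^ (k%:R * s)).
  rewrite (Rintegral_powR_sum a (fun k => 2 * s * (k%:R * s - 1) * r ^+ k) K s0) mulr_sumr;
      congr (_ + _); apply: eq_bigr => k _.
  by rewrite /toll_coef; ring.
have iI : mu.-integrable `[0, 1] (EFin \o integrand).
  by apply: within_integrable; exact: integrand_within_continuous.
have iP a : mu.-integrable `[0, 1] (EFin \o
    (fun v : R => a + \sum_(k < K) (2 * s * (k%:R * s - 1) * r ^+ k) * v `^ (k%:R * s))).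
  apply: within_integrable.
  exact: (@powR_sum_within_continuous R s a (fun k => 2 * s * (k%:R * s - 1) * r ^+ k) K s0).
have bnd v : `[0, 1]%classic v -> integrand_partial K v <= integrand v <= integrand_partial K
    v + e.
  by rewrite /= in_itv /= => v01; exact: (integrand_bounds K0 v01).
have PKe : C1_partial K + e = (2 + s + e) + 2 * s * \sum_(k < K) r ^+ k * toll_coef R k.
  by rewrite /C1_partial; ring.
apply/andP; split.
  rewrite /C1_partial PE C1E; apply: (@le_Rintegral _ _ _ mu _ _ integrand) => //.
  by move=> v /bnd/andP[].
rewrite PKe PE C1E; apply: (@le_Rintegral _ _ _ mu _ integrand) => //.
by move=> v /bnd/andP[_]; rewrite /integrand_partial addrAC.
Qed.

Lemma C1_eq_series : C1 R = C1_series R.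
Proof.
have /andP[r0 r1] := ratio_bounds R.
have cP : C1_partial K @[K --> \oo] --> C1_series R.
  apply: cvgD; first exact: cvg_cst.
  apply: cvgM; first exact: cvg_cst.
  have := @cvg_toll_term R 0; rewrite (_ : series _ = (fun K => \sum_(k < K) r ^+ k *
      toll_coef R k)) //.
  apply/funext => K; rewrite /series /= big_mkord; apply: eq_bigr => k _.
  by rewrite /toll_term bcoef0 mulr1.
have cE : (fun K => 14 * 2 * (1 / 2) ^+ K : R) @ \oo --> (0 : R).
  by apply: cvg_geometric; rewrite ger0_norm; lra.
(* [r <= 1 / 4], and of the two factors 1/2 one absorbs [K + 1]. *)
have err K : `|C1_partial K.+1 - C1 R| <= 14 * 2 * (1 / 2) ^+ K.
  have /andP[b1 b2] := C1_bounds (ltn0Sn K).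
  have h : K.+1%:R * r ^+ K.+1 <= 2 * (1 / 2) ^+ K.
    have h2 : 0 <= (1 / 2 : R) < 1 by apply/andP; split; lra.
    have := natmul_expr_le K h2; have -> : (1 - 1 / 2)^-1 = 2 :> R by field.
    move=> h3.
    apply: (@le_trans _ _ (K.+1%:R * (1 / 2 * (1 / 2)) ^+ K)).
      apply: ler_wpM2l => //; apply: (@le_trans _ _ (r ^+ K)).
        by rewrite exprSr; apply: ler_piMr; [exact/exprn_ge0/ltW | lra].
      by apply: lerXn2r; rewrite ?nnegrE; lra.
    by rewrite exprMn mulrA; apply: ler_wpM2r => //; apply: exprn_ge0; lra.
  by rewrite ler0_norm; lra.
suff cC : C1_partial @ \oo --> C1 R.
  by apply: (@cvg_unique _ _ (C1_partial @ \oo)) cC cP; exact: norm_hausdorff.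
have c0 : (fun K => C1_partial K.+1 - C1 R) @ \oo --> (0 : R).
  apply: norm_cvg0; apply: (squeeze_cvgr _ (cvg_cst 0) cE).
  by near=> K; rewrite normr_ge0 err.
have c1 : (fun K => (C1_partial K.+1 - C1 R) + C1 R) @ \oo --> 0 + C1 R.
  by apply: cvgD => //; exact: cvg_cst.
rewrite add0r in c1; rewrite -(cvg_shiftS C1_partial) /=.
by rewrite (_ : (fun K => C1_partial K.+1) = (fun K => (C1_partial K.+1 - C1 R) + C1 R)) //;
  apply/funext => K; rewrite subrK.
Unshelve. all: by end_near. Qed.

End Constant.

(** * Numerical value of [C1] *)

Section Numeric.
Variable R : realType.
Notation s := (sqrt5 R).
Notation r := (ratio R).

Definition ratio_lo : R := 145 / 10 ^+ 3 + 898 / 10 ^+ 6 + 33 / 10 ^+ 9.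
Definition ratio_hi : R := 145 / 10 ^+ 3 + 898 / 10 ^+ 6 + 35 / 10 ^+ 9.

Lemma sqrt5_fine : 2236 / 10 ^+ 3 + 67 / 10 ^+ 6 + 977 / 10 ^+ 9 <= s
    <= 2236 / 10 ^+ 3 + 67 / 10 ^+ 6 + 978 / 10 ^+ 9.
Proof. by rewrite le_sqrt5 ?ge_sqrt5; try apply/andP; try split; lra. Qed.

Lemma ratio_fine : ratio_lo <= r <= ratio_hi.
Proof. by have /andP[h1 h2] := sqrt5_fine; rewrite /ratio_lo /ratio_hi /ratio; apply/andP;
    split; lra. Qed.

(** [c] and [d] are rational bounds for [toll_coef], stated without division, so each term is
    enclosed by inequalities linear in [s] or purely numerical. *)
Lemma term_bounds (k : nat) (c d l u : R) :
  0 <= c -> c * (k%:R * s + 1) <= k%:R * s - 1 -> k%:R * s - 1 <= d * (k%:R * s + 1) ->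
  l <= ratio_lo ^+ k * c -> ratio_hi ^+ k * d <= u -> l <= r ^+ k * toll_coef R k <= u.
Proof.
move=> c0 hc hd hl hu; have k1 := mul_sqrt5D1_gt0 R k; have /andP[r1 r2] := ratio_fine.
have ra0 : 0 <= ratio_lo by rewrite /ratio_lo; lra.
have r0 : 0 <= r by apply: le_trans ra0 r1.
have cc : c <= toll_coef R k by rewrite /toll_coef ler_pdivlMr.
have cd : toll_coef R k <= d by rewrite /toll_coef ler_pdivrMr.
apply/andP; split.
  apply: le_trans hl _; apply: ler_pM; rewrite ?exprn_ge0 //.
  by apply: lerXn2r; rewrite ?nnegrE.
apply: le_trans hu; apply: ler_pM; rewrite ?exprn_ge0 ?(le_trans c0 cc) //.
by apply: lerXn2r; rewrite ?nnegrE // (le_trans r0 r2).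
Qed.

Definition toll_sum10 : R :=
  r ^+ 1 * toll_coef R 1 + r ^+ 2 * toll_coef R 2 + r ^+ 3 * toll_coef R 3
  + r ^+ 4 * toll_coef R 4 + r ^+ 5 * toll_coef R 5 + r ^+ 6 * toll_coef R 6
  + r ^+ 7 * toll_coef R 7 + r ^+ 8 * toll_coef R 8 + r ^+ 9 * toll_coef R 9
  + r ^+ 10 * toll_coef R 10.

Lemma toll_sum10_bounds : 71 / 10 ^+ 3 + 961 / 10 ^+ 6 + 268 / 10 ^+ 9 <= toll_sum10
    <= 71 / 10 ^+ 3 + 961 / 10 ^+ 6 + 280 / 10 ^+ 9.
Proof.
have /andP[s1 s2] := sqrt5_fine.
(* Here and below, the two rationals given to [term_bounds] bracket [toll_coef] to about nine
   decimals. *)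
have t1 : 55 / 10 ^+ 3 + 728 / 10 ^+ 6 + 89 / 10 ^+ 9 <= r ^+ 1 * toll_coef R 1
    <= 55 / 10 ^+ 3 + 728 / 10 ^+ 6 + 91 / 10 ^+ 9.
  clear -s1 s2; apply: (@term_bounds 1 (381 / 10 ^+ 3 + 966 / 10 ^+ 6 + 11 / 10 ^+ 9)
    (381 / 10 ^+ 3 + 966 / 10 ^+ 6 + 12 / 10 ^+ 9)); rewrite /ratio_lo /ratio_hi; lra.
have t2 : 13 / 10 ^+ 3 + 506 / 10 ^+ 6 + 372 / 10 ^+ 9 <= r ^+ 2 * toll_coef R 2
    <= 13 / 10 ^+ 3 + 506 / 10 ^+ 6 + 373 / 10 ^+ 9.
  clear -s1 s2; apply: (@term_bounds 2 (634 / 10 ^+ 3 + 512 / 10 ^+ 6 + 4 / 10 ^+ 9)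
    (634 / 10 ^+ 3 + 512 / 10 ^+ 6 + 5 / 10 ^+ 9)); rewrite /ratio_lo /ratio_hi; lra.
have t3 : 2 / 10 ^+ 3 + 299 / 10 ^+ 6 + 823 / 10 ^+ 9 <= r ^+ 3 * toll_coef R 3
    <= 2 / 10 ^+ 3 + 299 / 10 ^+ 6 + 825 / 10 ^+ 9.
  clear -s1 s2; apply: (@term_bounds 3 (740 / 10 ^+ 3 + 536 / 10 ^+ 6 + 184 / 10 ^+ 9)
    (740 / 10 ^+ 3 + 536 / 10 ^+ 6 + 185 / 10 ^+ 9)); rewrite /ratio_lo /ratio_hi; lra.
have t4 : 361 / 10 ^+ 6 + 975 / 10 ^+ 9 <= r ^+ 4 * toll_coef R 4
    <= 361 / 10 ^+ 6 + 976 / 10 ^+ 9.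
  clear -s1 s2; apply: (@term_bounds 4 (798 / 10 ^+ 3 + 879 / 10 ^+ 6 + 192 / 10 ^+ 9)
    (798 / 10 ^+ 3 + 879 / 10 ^+ 6 + 193 / 10 ^+ 9)); rewrite /ratio_lo /ratio_hi; lra.
have t5 : 55 / 10 ^+ 6 + 252 / 10 ^+ 9 <= r ^+ 5 * toll_coef R 5
    <= 55 / 10 ^+ 6 + 253 / 10 ^+ 9.
  clear -s1 s2; apply: (@term_bounds 5 (835 / 10 ^+ 3 + 800 / 10 ^+ 6 + 969 / 10 ^+ 9)
    (835 / 10 ^+ 3 + 800 / 10 ^+ 6 + 970 / 10 ^+ 9)); rewrite /ratio_lo /ratio_hi; lra.
have t6 : 8 / 10 ^+ 6 + 306 / 10 ^+ 9 <= r ^+ 6 * toll_coef R 6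
    <= 8 / 10 ^+ 6 + 307 / 10 ^+ 9.
  clear -s1 s2; apply: (@term_bounds 6 (861 / 10 ^+ 3 + 269 / 10 ^+ 6 + 185 / 10 ^+ 9)
    (861 / 10 ^+ 3 + 269 / 10 ^+ 6 + 186 / 10 ^+ 9)); rewrite /ratio_lo /ratio_hi; lra.
have t7 : 1 / 10 ^+ 6 + 238 / 10 ^+ 9 <= r ^+ 7 * toll_coef R 7
    <= 1 / 10 ^+ 6 + 239 / 10 ^+ 9.
  clear -s1 s2; apply: (@term_bounds 7 (879 / 10 ^+ 3 + 897 / 10 ^+ 6 + 738 / 10 ^+ 9)
    (879 / 10 ^+ 3 + 897 / 10 ^+ 6 + 740 / 10 ^+ 9)); rewrite /ratio_lo /ratio_hi; lra.
have t8 : 183 / 10 ^+ 9 <= r ^+ 8 * toll_coef R 8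
    <= 184 / 10 ^+ 9.
  clear -s1 s2; apply: (@term_bounds 8 (894 / 10 ^+ 3 + 115 / 10 ^+ 6 + 712 / 10 ^+ 9)
    (894 / 10 ^+ 3 + 115 / 10 ^+ 6 + 713 / 10 ^+ 9)); rewrite /ratio_lo /ratio_hi; lra.
have t9 : 27 / 10 ^+ 9 <= r ^+ 9 * toll_coef R 9
    <= 28 / 10 ^+ 9.
  clear -s1 s2; apply: (@term_bounds 9 (905 / 10 ^+ 3 + 323 / 10 ^+ 6 + 703 / 10 ^+ 9)
    (905 / 10 ^+ 3 + 323 / 10 ^+ 6 + 704 / 10 ^+ 9)); rewrite /ratio_lo /ratio_hi; lra.
have t10 : 3 / 10 ^+ 9 <= r ^+ 10 * toll_coef R 10
    <= 4 / 10 ^+ 9.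
  clear -s1 s2; apply: (@term_bounds 10 (914 / 10 ^+ 3 + 386 / 10 ^+ 6 + 52 / 10 ^+ 9)
    (914 / 10 ^+ 3 + 386 / 10 ^+ 6 + 54 / 10 ^+ 9)); rewrite /ratio_lo /ratio_hi; lra.
move: t1 t2 t3 t4 t5 t6 t7 t8 t9 t10.
rewrite /toll_sum10; move: (r ^+ 1 * toll_coef R 1) (r ^+ 2 * toll_coef R 2) (r ^+ 3 *
    toll_coef R 3) (r ^+ 4 * toll_coef R 4) (r ^+ 5 * toll_coef R 5) (r ^+ 6 * toll_coef R 6)
    (r ^+ 7 * toll_coef R 7) (r ^+ 8 * toll_coef R 8) (r ^+ 9 * toll_coef R 9) (r ^+ 10 *
    toll_coef R 10).
clear.
move=> x1 x2 x3 x4 x5 x6 x7 x8 x9 x10.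
move=> /andP[a1 b1] /andP[a2 b2] /andP[a3 b3] /andP[a4 b4] /andP[a5 b5] /andP[a6 b6] /andP[a7
    b7] /andP[a8 b8] /andP[a9 b9] /andP[a10 b10].
apply/andP; split.
  clear b1 b2 b3 b4 b5 b6 b7 b8 b9 b10; lra.
clear a1 a2 a3 a4 a5 a6 a7 a8 a9 a10; lra.
Qed.

Lemma C1_partial11_bounds : 85 / 10 ^+ 3 + 752 / 10 ^+ 6 + 590 / 10 ^+ 9 <= C1_partial R 11
    <= 85 / 10 ^+ 3 + 753 / 10 ^+ 6.
Proof.
(* The term [k = 0] is -1, which turns [2 + s] into [2 - s]. *)
have -> : C1_partial R 11 = 2 - s + 2 * s * toll_sum10.
  rewrite /toll_sum10 /C1_partial big_ord_recl expr0 mul1r {1}/toll_coef mul0r sub0r add0r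
      divr1.
  by rewrite !big_ord_recr big_ord0 /bump /=; ring.
have /andP[s1 s2] := sqrt5_fine; have s0 := sqrt5_ge0 R; have := toll_sum10_bounds.
move: (toll_sum10) (s) s0 s1 s2; clear => T t t0 t1 t2 /andP[T1 T2].
have c0 : 0 <= 71 / 10 ^+ 3 + 961 / 10 ^+ 6 + 268 / 10 ^+ 9 :> R by clear; lra.
have c1 : 0 <= 2236 / 10 ^+ 3 + 67 / 10 ^+ 6 + 977 / 10 ^+ 9 :> R by clear; lra.
have p1 := ler_pM c1 c0 t1 T1.
have p2 := ler_pM t0 (le_trans c0 T1) t2 T2.
clear T1 T2 c0 c1 t0.
by apply/andP; split; lra.
Qed.

Lemma error11 : 14 * 11 * r ^+ 11 <= 1 / 10 ^+ 7.
Proof.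
have /andP[r1 r2] := ratio_fine; have /andP[r0 _] := ratio_bounds R.
apply: (@le_trans _ _ (14 * 11 * ratio_hi ^+ 11)).
  apply: ler_wpM2l; first by rewrite mulr_ge0.
  by apply: lerXn2r; rewrite ?nnegrE ?(le_trans (ltW r0) r2) // ltW.
by rewrite /ratio_hi; clear; lra.
Qed.

Lemma C1_numeric : `|C1 R - (85 / 10 ^+ 3 + 753 / 10 ^+ 6)| < 5 / 10 ^+ 7.
Proof.
have /andP[lo hi] := @C1_bounds R 11 isT.
have e := error11; have /andP[p1 p2] := C1_partial11_bounds.
move: (14 * 11 * r ^+ 11) (C1_partial R 11) (C1 R) => E P C in lo hi e p1 p2 *.
by rewrite ltr_norml; apply/andP; split; lra.
Qed.

End Numeric.

(** * Assembly of the asymptotic estimate *)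

Lemma shifted_pow_le_powR (R : realType) (n : nat) : (0 < n)%N ->
  shifted_pow R n <= n%:R `^ (- sqrt5 R).
Proof.
move=> n0; have n1 : 0 < n%:R :> R by rewrite ltr0n.
have n11 : n%:R <= n%:R + 11 :> R by rewrite lerDl.
have n2 : 0 < n%:R + 11 :> R by apply: lt_le_trans n11.
rewrite /shifted_pow !powRN lef_pV2 ?posrE ?powR_gt0 //.
by apply: ge0_ler_powR => //; rewrite ?nnegrE ?sqrt5_ge0 // ltW.
Qed.

Theorem proposition4p5 (R : realType) :
  (fun n : nat => mean_binary_increasing n (fun T => (N0 R T)%:R : R))
    = (fun n : nat => C1 R * (n%:R + 1) + Num.sqrt 5 - 2)
      +O_\oo (fun n : nat => n%:R `^ (- Num.sqrt 5))
  /\ `|C1 R - (85 / 10 ^+ 3 + 753 / 10 ^+ 6)| < 5 / 10 ^+ 7.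
Proof.
split; last exact: C1_numeric.
have [A [A0 HA]] := mean_nullity_asymp R.
(* The bound must be positive, while [A] is only known to be nonnegative. *)
apply/eqaddOP/bigO_exP; exists (A + 1); first by rewrite ltr_wpDl.
near=> n.
(* At [n = 0] the comparison function takes the value 0, so that index is discarded. *)
have n0 : (0 < n)%N by near: n; exact: nbhs_infty_gt.
rewrite !fctE (mean_N0 (cover_prob0 R) (cover_probS R) (mean_nullity0 R) (mean_nullityS R))
    C1_eq_series natr1 -/(sqrt5 R).
apply: le_trans (HA n) _.
rewrite ger0_norm ?powR_ge0 //; apply: ler_pM => //;
    [exact/ltW/shifted_pow_gt0 | by rewrite lerDl | exact: shifted_pow_le_powR].
Unshelve. all: by end_near. Qed.
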